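(* Let $\eta>1/3$ and let $v:[0,T_*]\to L^2_0(\mathbb{T})$ be a solution of the KdV $\Lambda$-equation in $L^2_0$, i.e. $v$ is $\eta$-Hölder in $L^2$, the increment $\delta v_{ts}-X_{ts}(v_s,v_s)$ satisfies $|\delta v_{ts}-X_{ts}(v_s,v_s)|_{L^2}\lesssim|t-s|^{2\eta}$, and $v^\flat_{ts}:=\delta v_{ts}-X_{ts}(v_s,v_s)-X^2_{ts}(v_s,v_s,v_s)$ satisfies $|v^\flat_{ts}|_{L^2}\lesssim|t-s|^{3\eta}$, with initial condition $v_0\in L^2_0(\mathbb{T})$. Then $|v_t|_{L^2(\mathbb{T})}^2=|v_0|_{L^2(\mathbb{T})}^2$ for all $t\in[0,T_*]$.
   Context: $L^2_0(\mathbb{T})$ denotes real $L^2$ functions on $\mathbb{T}=[-\pi,\pi]$ with zero mean ($\hat f(0)=0$, where $f(\xi)=\sum_k\hat f(k)e^{ik\xi}$). $\delta v_{ts}=v_t-v_s$. $\dot X_\sigma$: $\widehat{\dot X_\sigma(\varphi_1,\varphi_2)}(k)=\frac{ik}{2}\sum_{k_1\ne0,k}e^{-3ikk_1k_2\sigma}\hat\varphi_1(k_1)\hat\varphi_2(k_2)$, $k_2=k-k_1$; $X_{ts}=\int_s^t\dot X_\sigma d\sigma$, i.e. $\widehat{X_{ts}(\varphi_1,\varphi_2)}(k)=\sum_{k_1\ne0,k}\frac{e^{-3ikk_1k_2s}-e^{-3ikk_1k_2t}}{6k_1k_2}\hat\varphi_1(k_1)\hat\varphi_2(k_2)$; $X^2_{ts}(\varphi_1,\varphi_2,\varphi_3)=2\int_s^td\sigma\int_s^\sigma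 d\sigma_1\dot X_\sigma(\varphi_1,\dot X_{\sigma_1}(\varphi_2,\varphi_3))$ (bounded bi-/trilinear operators on $L^2_0$). Equivalently $v$ satisfies $\delta v=(\mathrm{id}-\Lambda\delta)[X(v,v)+X^2(v,v,v)]$ with $\Lambda$ the sewing map. *)

(* Defs.v *)
(* Elements of L^2_0(T) are represented by
   their Fourier coefficient sequences  fhat : Z -> C,  f(xi) = sum_k fhat(k) e^{ik xi}. *)
From Stdlib Require Import Reals ZArith.
From Coquelicot Require Import Coquelicot.
Open Scope R_scope.

Definition cexpi (x : R) : C := (cos x, sin x).

Definition fourier := Z -> C.

(* n-th term of sum_{k in Z} |fhat k|^2, grouping k = n+1 and k = -(n+1);
   the k = 0 term is added separately *)
Definition sq_term (f : fourier) (n : nat) : R :=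
  (Cmod (f (Z.of_nat (S n))))^2 + (Cmod (f (- Z.of_nat (S n))%Z))^2.

(* f is the coefficient sequence of an element of L^2_0(T): real valued
   (fhat(-k) = conj fhat(k)), zero mean, square summable *)
Definition isL20 (f : fourier) : Prop :=
  f 0%Z = RtoC 0 /\
  (forall k : Z, f (- k)%Z = Cconj (f k)) /\
  ex_series (sq_term f).

(* |f|_{L^2(T)}^2 = int_{-pi}^{pi} |f|^2 = 2 pi sum_{k in Z} |fhat k|^2 (Parseval) *)
Definition L2norm2 (f : fourier) : R :=
  2 * PI * ((Cmod (f 0%Z))^2 + Series (sq_term f)).

Definition L2norm (f : fourier) : R := sqrt (L2norm2 f).

Definition L2_le (f : fourier) (c : R) : Prop :=
  ex_series (sq_term f) /\ L2norm f <= c.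

Definition fsub (f g : fourier) : fourier := fun k => Cminus (f k) (g k).

Fixpoint zsum_aux (g : Z -> C) (N : nat) (i : nat) : C :=
  match i with
  | O => RtoC 0
  | S i' => Cplus (g (Z.of_nat i' - Z.of_nat N)%Z) (zsum_aux g N i')
  end.
Definition zbox (g : Z -> C) (N : nat) : C := zsum_aux g N (2 * N + 1).

Definition climit (u : nat -> C) : C :=
  (real (Lim_seq (fun n => Re (u n))), real (Lim_seq (fun n => Im (u n)))).

(* sum over k in Z, as the limit of symmetric partial sums (the series below
   are absolutely convergent, so this is the usual sum) *)
Definition zsum (g : Z -> C) : C := climit (zbox g).
Definition zsum2 (g : Z -> Z -> C) : C :=
  climit (fun N => zbox (fun j => zbox (g j) N) N).

Definition IZC (z : Z) : C := RtoC (IZR z).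

Definition Xop (t s : R) (phi1 phi2 : fourier) : fourier := fun k =>
  zsum (fun k1 =>
    let k2 := (k - k1)%Z in
    if (Z.eqb k1 0 || Z.eqb k1 k)%bool then RtoC 0 else
    let a := 3 * IZR k * IZR k1 * IZR k2 in
    Cmult (Cdiv (Cminus (cexpi (- a * s)) (cexpi (- a * t))) (RtoC (6 * IZR k1 * IZR k2)))
          (Cmult (phi1 k1) (phi2 k2))).

(* J(a,b,s,t) = int_s^t dsigma int_s^sigma dsigma1 e^{-i a sigma} e^{-i b sigma1} *)
Definition Jint (a b s t : R) : C :=
  (RInt (fun sg => RInt (fun sg1 => cos (a * sg + b * sg1)) s sg) s t,
   - RInt (fun sg => RInt (fun sg1 => sin (a * sg + b * sg1)) s sg) s t).

(* X^2_{ts}(phi1,phi2,phi3) = 2 int_s^t dsigma int_s^sigma dsigma1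
      Xdot_sigma(phi1, Xdot_sigma1(phi2,phi3)),  written in Fourier variables:
   ^(k) = sum_{k1 <> 0,k} sum_{m1 <> 0,k2} 2 (ik/2)(ik2/2) J(3kk1k2, 3k2m1m2, s, t)
            phi1^(k1) phi2^(m1) phi3^(m2),   k2 = k - k1, m2 = k2 - m1. *)
Definition X2op (t s : R) (phi1 phi2 phi3 : fourier) : fourier := fun k =>
  zsum2 (fun k1 m1 =>
    let k2 := (k - k1)%Z in
    let m2 := (k2 - m1)%Z in
    if (Z.eqb k1 0 || Z.eqb k1 k || Z.eqb m1 0 || Z.eqb m1 k2)%bool then RtoC 0 else
    Cmult (RtoC 2)
     (Cmult (0, IZR k / 2)
      (Cmult (0, IZR k2 / 2)
       (Cmult (Jint (3 * IZR k * IZR k1 * IZR k2) (3 * IZR k2 * IZR m1 * IZR m2) s t)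
        (Cmult (phi1 k1) (Cmult (phi2 m1) (phi3 m2))))))).

Definition vnat (v : R -> fourier) (t s : R) : fourier :=
  fsub (fsub (v t) (v s)) (Xop t s (v s) (v s)).

Definition vflat (v : R -> fourier) (t s : R) : fourier :=
  fsub (vnat v t s) (X2op t s (v s) (v s) (v s)).

Definition KdV_Lambda_solution (eta T : R) (v : R -> fourier) : Prop :=
  (forall t, 0 <= t <= T -> isL20 (v t)) /\
  (exists C1, forall s t, 0 <= s <= t -> t <= T ->
      L2_le (fsub (v t) (v s)) (C1 * Rpower (t - s) eta)) /\
  (exists C2, forall s t, 0 <= s <= t -> t <= T ->
      L2_le (vnat v t s) (C2 * Rpower (t - s) (2 * eta))) /\
  (exists C3, forall s t, 0 <= s <= t -> t <= T ->
      L2_le (vflat v t s) (C3 * Rpower (t - s) (3 * eta))).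

(* Main.v *)
(* Write f = v_s, d = v_t - v_s, X = X_ts(f,f), X2 = X^2_ts(f,f,f), w = d - X, r = w - X2.
   Expanding, |v_t|^2 - |f|^2 = 2<f,X> + (2<f,X2> + |X|^2) + 2<f,r> + 2<X,w> + |w|^2.
   The first two groups vanish: in Fourier variables <f,X> and <f,X2> are absolutely
   convergent sums over k1+k2+k3 = 0 and k1+...+k4 = 0, and both identities follow by
   permuting the frequencies. The rest is O(|t-s|^{3 eta}), and 3 eta > 1. *)
Require Import Defs.
From Stdlib Require Import Reals ZArith Lra Lia List FinFun.
From Stdlib Require Import Classical ClassicalEpsilon.
From Coquelicot Require Import Coquelicot.
Open Scope R_scope.

(** * Unconditional sums *)

(** The operators are defined as limits of symmetric partial sums, and such limits do not allow
    frequencies to be permuted. Everything is therefore moved to unconditional sums over arbitrary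
    index types, where domination, bijective reindexing and Fubini hold. The real cost is absolute
    convergence: coefficients are only square summable, while each bilinear operator carries a
    derivative, that is a factor equal to the output frequency. Integration in time divides by the
    phase. For X the phase contains the output frequency, and the weight 1/(k1 k2) remains. In the
    cubic pairing a second integral appears whose phase lacks the outer frequency and vanishes on
    two resonant planes. Off the planes the outer frequency is split over the available factors. On
    them the integral is only t - s, but one summation disappears. Both cancellations are exact
    identities for every f, s and t, so time regularity enters only through the remainder. There X
    is never estimated: it is replaced by d - w, whose sizes are given. The pairings are bounded
    frequency by frequency by a weighted AM-GM inequality, with weights equal to powers of
    |t-s|^eta. *)

Fixpoint lsum {A : Type} (f : A -> R) (l : list A) : R :=
  match l with
  | nil => 0
  | x :: l' => f x + lsum f l'
  end.

Lemma lsum_app {A} (f : A -> R) l1 l2 :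
  lsum f (l1 ++ l2) = lsum f l1 + lsum f l2.
Proof. induction l1 as [|x l1 IH]; simpl; [ring | rewrite IH; ring]. Qed.

Lemma lsum_ext_in {A} (f g : A -> R) l :
  (forall x, In x l -> f x = g x) -> lsum f l = lsum g l.
Proof.
  induction l as [|x l IH]; intros H; simpl; [reflexivity|].
  rewrite (H x (or_introl eq_refl)), IH; [reflexivity|].
  intros y Hy; apply H; right; exact Hy.
Qed.

Lemma lsum_le {A} (f g : A -> R) l :
  (forall x, In x l -> f x <= g x) -> lsum f l <= lsum g l.
Proof.
  induction l as [|x l IH]; intros H; simpl; [lra|].
  apply Rplus_le_compat; [apply H; left; reflexivity|].
  apply IH; intros y Hy; apply H; right; exact Hy.
Qed.

Lemma lsum_nonneg {A} (f : A -> R) l : (forall x, 0 <= f x) -> 0 <= lsum f l.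
Proof.
  intros H; induction l as [|x l IH]; simpl; [lra|].
  specialize (H x); lra.
Qed.

Lemma lsum_lin {A} (a b : R) (f g : A -> R) l :
  lsum (fun x => a * f x + b * g x) l = a * lsum f l + b * lsum g l.
Proof. induction l as [|x l IH]; simpl; [ring | rewrite IH; ring]. Qed.

Lemma lsum_scal {A} (a : R) (f : A -> R) l :
  lsum (fun x => a * f x) l = a * lsum f l.
Proof. induction l as [|x l IH]; simpl; [ring | rewrite IH; ring]. Qed.

Lemma lsum_map {A B} (e : B -> A) (f : A -> R) l :
  lsum f (map e l) = lsum (fun x => f (e x)) l.
Proof. induction l as [|x l IH]; simpl; [|rewrite IH]; reflexivity. Qed.

Lemma lsum_incl {A} (f : A -> R) l0 l :
  (forall x, 0 <= f x) -> NoDup l0 -> incl l0 l -> lsum f l0 <= lsum f l.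
Proof.
  intros Hf; revert l; induction l0 as [|x l0 IH]; intros l Hnd Hi; simpl.
  - apply lsum_nonneg, Hf.
  - destruct (in_split x l (Hi x (or_introl eq_refl))) as (l1 & l2 & ->).
    inversion Hnd as [|? ? Hx Hnd']; subst.
    assert (H : lsum f l0 <= lsum f (l1 ++ l2)).
    { apply IH; [exact Hnd'|]. intros y Hy.
      assert (Hy' := Hi y (or_intror Hy)).
      apply in_app_or in Hy'; apply in_or_app.
      destruct Hy' as [|[->|]]; tauto. }
    rewrite lsum_app in *; simpl; lra.
Qed.

Lemma NoDup_superset {A} (l : list A) : exists l', NoDup l' /\ incl l l'.
Proof.
  pose (dec := fun x y : A => excluded_middle_informative (x = y)).
  exists (nodup dec l); split; [apply NoDup_nodup|].
  intros x Hx; apply nodup_In, Hx.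
Qed.

(** Convergence along the net of finite subsets, encoded as duplicate-free lists. No enumeration of
    [A] is chosen, so invariance under bijections is immediate. *)
Definition has_sum {A : Type} (f : A -> R) (S : R) : Prop :=
  forall eps, 0 < eps -> exists l0, forall l,
    NoDup l -> incl l0 l -> Rabs (lsum f l - S) <= eps.

(** For nonnegative [f] this is summability with an explicit bound on the total. Majorants are kept
    in this form because it passes through injections and products without naming a limit. *)
Definition sum_le {A : Type} (f : A -> R) (K : R) : Prop :=
  forall l, NoDup l -> lsum f l <= K.

Lemma has_sum_ext {A} (f g : A -> R) S :
  (forall x, f x = g x) -> has_sum f S -> has_sum g S.
Proof.
  intros H Hf eps He; destruct (Hf eps He) as [l0 Hl0]; exists l0.
  intros l H1 H2; rewrite <- (lsum_ext_in f g) by auto; auto.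
Qed.

Lemma has_sum_unique {A} (f : A -> R) S S' :
  has_sum f S -> has_sum f S' -> S = S'.
Proof.
  intros H H'; apply NNPP; intros Hne.
  assert (He : 0 < Rabs (S - S') / 3).
  { assert (0 < Rabs (S - S')) by (apply Rabs_pos_lt; lra); lra. }
  destruct (H _ He) as [l1 H1]; destruct (H' _ He) as [l2 H2].
  destruct (NoDup_superset (l1 ++ l2)) as (l & Hnd & Hi).
  specialize (H1 l Hnd (fun x Hx => Hi x (in_or_app _ _ _ (or_introl Hx)))).
  specialize (H2 l Hnd (fun x Hx => Hi x (in_or_app _ _ _ (or_intror Hx)))).
  revert He H1 H2; unfold Rabs; repeat destruct Rcase_abs; lra.
Qed.

Lemma has_sum_plus {A} (f g : A -> R) S S' :
  has_sum f S -> has_sum g S' -> has_sum (fun x => f x + g x) (S + S').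
Proof.
  intros H H' eps He.
  destruct (H (eps / 2)) as [l1 H1]; [lra|].
  destruct (H' (eps / 2)) as [l2 H2]; [lra|].
  exists (l1 ++ l2); intros l Hnd Hi.
  specialize (H1 l Hnd (fun x Hx => Hi x (in_or_app _ _ _ (or_introl Hx)))).
  specialize (H2 l Hnd (fun x Hx => Hi x (in_or_app _ _ _ (or_intror Hx)))).
  replace (lsum (fun x => f x + g x) l) with (lsum f l + lsum g l).
  - replace (lsum f l + lsum g l - (S + S')) with ((lsum f l - S) + (lsum g l - S')) by ring.
    eapply Rle_trans; [apply Rabs_triang|lra].
  - rewrite <- (Rmult_1_l (lsum f l)), <- (Rmult_1_l (lsum g l)), <- lsum_lin.
    apply lsum_ext_in; intros; ring.
Qed.

Lemma has_sum_scal {A} (a : R) (f : A -> R) S :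
  has_sum f S -> has_sum (fun x => a * f x) (a * S).
Proof.
  intros H eps He.
  assert (Hp : 0 < Rabs a + 1) by (assert (H0 := Rabs_pos a); lra).
  destruct (H (eps / (Rabs a + 1))) as [l0 H0].
  { apply Rdiv_lt_0_compat; lra. }
  exists l0; intros l Hnd Hi; rewrite lsum_scal.
  replace (a * lsum f l - a * S) with (a * (lsum f l - S)) by ring.
  rewrite Rabs_mult; specialize (H0 l Hnd Hi).
  apply Rle_trans with ((Rabs a + 1) * (eps / (Rabs a + 1))).
  - apply Rmult_le_compat; try apply Rabs_pos; lra.
  - right; field; lra.
Qed.

Lemma has_sum_0 {A} : has_sum (fun _ : A => 0) 0.
Proof.
  intros eps He; exists nil; intros l _ _.
  replace (lsum _ l) with 0 by (induction l; simpl; lra).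
  rewrite Rminus_0_r, Rabs_R0; lra.
Qed.

Lemma has_sum_minus {A} (f g : A -> R) S S' :
  has_sum f S -> has_sum g S' -> has_sum (fun x => f x - g x) (S - S').
Proof.
  intros H H'; replace (S - S') with (S + (-1) * S') by ring.
  eapply has_sum_ext; [|apply has_sum_plus; [exact H|apply has_sum_scal, H']].
  intros x; simpl; ring.
Qed.

Lemma has_sum_le {A} (f g : A -> R) S S' :
  (forall x, f x <= g x) -> has_sum f S -> has_sum g S' -> S <= S'.
Proof.
  intros Hle H H'; apply Rnot_lt_le; intros Hlt.
  assert (He : 0 < (S - S') / 3) by lra.
  destruct (H _ He) as [l1 H1]; destruct (H' _ He) as [l2 H2].
  destruct (NoDup_superset (l1 ++ l2)) as (l & Hnd & Hi).
  specialize (H1 l Hnd (fun x Hx => Hi x (in_or_app _ _ _ (or_introl Hx)))).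
  specialize (H2 l Hnd (fun x Hx => Hi x (in_or_app _ _ _ (or_intror Hx)))).
  assert (H3 := lsum_le f g l (fun x _ => Hle x)).
  apply Rabs_le_between in H1; apply Rabs_le_between in H2; lra.
Qed.

Lemma has_sum_nonneg_ex {A} (f : A -> R) K :
  (forall x, 0 <= f x) -> sum_le f K -> exists S, has_sum f S.
Proof.
  intros Hf HK.
  destruct (completeness (fun y => exists l, NoDup l /\ y = lsum f l)) as [S [Hub Hlub]].
  - exists K; intros y (l & Hl & ->); apply HK, Hl.
  - exists 0, nil; split; [constructor|reflexivity].
  - exists S; intros eps He.
    destruct (classic (exists l0, NoDup l0 /\ S - eps < lsum f l0)) as [(l0 & Hnd0 & H0)|Hno].
    + exists l0; intros l Hnd Hi.
      assert (H1 := lsum_incl f l0 l Hf Hnd0 Hi).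
      assert (H2 := Hub _ (ex_intro _ l (conj Hnd eq_refl))).
      apply Rabs_le_between; lra.
    + exfalso; assert (S <= S - eps); [|lra].
      apply Hlub; intros y (l & Hl & ->); apply Rnot_lt_le; intros Hlt.
      apply Hno; exists l; auto.
Qed.

(** Uses f = (f + |f|) - |f|, a difference of two nonnegative families with bounded partial sums. *)
Lemma has_sum_abs_ex {A} (f : A -> R) K :
  sum_le (fun x => Rabs (f x)) K -> exists S, has_sum f S.
Proof.
  intros HK.
  destruct (has_sum_nonneg_ex (fun x => Rabs (f x)) K) as [S1 H1];
    [intros; apply Rabs_pos|exact HK|].
  destruct (has_sum_nonneg_ex (fun x => f x + Rabs (f x)) (K + K)) as [S2 H2].
  - intros x; unfold Rabs; destruct Rcase_abs; lra.
  - intros l Hl; apply Rle_trans with (1 * lsum (fun x => Rabs (f x)) l + 1 * lsum (fun x => Rabs (f x)) l).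
    + rewrite <- lsum_lin; apply lsum_le; intros x _.
      assert (H := Rle_abs (f x)); lra.
    + assert (H := HK l Hl); lra.
  - exists (S2 - S1); eapply has_sum_ext; [|exact (has_sum_minus _ _ _ _ H2 H1)].
    intros x; simpl; ring.
Qed.

Lemma has_sum_sum_le {A} (f : A -> R) S :
  (forall x, 0 <= f x) -> has_sum f S -> sum_le f S.
Proof.
  intros Hf H l Hl; apply le_epsilon; intros eps He.
  destruct (H eps He) as [l0 H0].
  destruct (NoDup_superset (l0 ++ l)) as (l' & Hnd & Hi).
  specialize (H0 l' Hnd (fun x Hx => Hi x (in_or_app _ _ _ (or_introl Hx)))).
  assert (H1 := lsum_incl f l l' Hf Hl (fun x Hx => Hi x (in_or_app _ _ _ (or_intror Hx)))).
  apply Rabs_le_between in H0; lra.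
Qed.

Lemma has_sum_reindex {A B} (e : B -> A) (e' : A -> B) (f : A -> R) S :
  (forall x, e (e' x) = x) -> (forall y, e' (e y) = y) ->
  has_sum f S -> has_sum (fun y => f (e y)) S.
Proof.
  intros H1 H2 Hf eps He; destruct (Hf eps He) as [l0 H0].
  exists (map e' l0); intros l Hnd Hi.
  rewrite <- lsum_map; apply H0.
  - apply FinFun.Injective_map_NoDup; [|exact Hnd].
    intros y z Hyz; rewrite <- (H2 y), <- (H2 z), Hyz; reflexivity.
  - intros x Hx; rewrite <- (H1 x); apply in_map, Hi, in_map, Hx.
Qed.

Lemma has_sum_fubini {A B} (F : A * B -> R) (g : A -> R) S :
  has_sum F S -> (forall a, has_sum (fun b => F (a, b)) (g a)) -> has_sum g S.
Proof.
  intros HF Hg eps He.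
  destruct (HF (eps / 2)) as [l0 H0]; [lra|].
  exists (map fst l0); intros la Hnd Hi.
  (* Over the finite set [la] of rows, each row sum is replaced by a finite piece of that row
     containing the points of [l0] in it. The error budget is halved at each row, so the total error
     stays below [d] however many rows there are. *)
  assert (Hap : forall la, NoDup la -> forall d, 0 < d -> exists lp, NoDup lp /\
    (forall x, In x lp -> In (fst x) la) /\
    (forall x, In x l0 -> In (fst x) la -> In x lp) /\
    Rabs (lsum F lp - lsum g la) <= d).
  { clear la Hnd Hi; intros la; induction la as [|a la IH]; intros Hnd d Hd.
    - exists nil; split; [constructor|].
      split; [intros x []|split; [intros x _ []|]].
      simpl; rewrite Rminus_0_r, Rabs_R0; lra.
    - inversion Hnd as [|? ? Ha Hnd']; subst.
      destruct (IH Hnd' (d / 2)) as (lp & Hp1 & Hp2 & Hp3 & Hp4); [lra|].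
      destruct (Hg a (d / 2)) as [lb0 Hb0]; [lra|].
      destruct (NoDup_superset (lb0 ++ map snd l0)) as (lb & Hb1 & Hb2).
      specialize (Hb0 lb Hb1 (fun x Hx => Hb2 x (in_or_app _ _ _ (or_introl Hx)))).
      exists (map (pair a) lb ++ lp); split; [|split; [|split]].
      + apply NoDup_app; [|exact Hp1|].
        * apply FinFun.Injective_map_NoDup; [|exact Hb1].
          intros y z Hyz; injection Hyz; auto.
        * intros x Hx Hx'; apply in_map_iff in Hx; destruct Hx as (b & <- & _).
          apply Hp2 in Hx'; simpl in Hx'; tauto.
      + intros x Hx; apply in_app_or in Hx; destruct Hx as [Hx|Hx].
        * apply in_map_iff in Hx; destruct Hx as (b & <- & _); left; reflexivity.
        * right; apply Hp2, Hx.
      + intros [a' b] Hx [Hx'|Hx']; apply in_or_app.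
        * left; simpl in Hx'; subst a'; apply in_map, Hb2, in_or_app; right.
          change b with (snd (a, b)); apply in_map, Hx.
        * right; apply Hp3; assumption.
      + rewrite lsum_app, lsum_map; simpl.
        replace (_ - _) with ((lsum (fun x => F (a, x)) lb - g a) + (lsum F lp - lsum g la)) by ring.
        eapply Rle_trans; [apply Rabs_triang|lra]. }
  destruct (Hap la Hnd (eps / 2)) as (lp & Hp1 & _ & Hp3 & Hp4); [lra|].
  assert (H1 : Rabs (lsum F lp - S) <= eps / 2).
  { apply H0; [exact Hp1|]; intros x Hx; apply Hp3; [exact Hx|].
    apply Hi, in_map, Hx. }
  apply Rabs_le_between in H1; apply Rabs_le_between in Hp4; apply Rabs_le_between; lra.
Qed.

Lemma sum_le_mono {A} (f g : A -> R) K K' :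
  (forall x, f x <= g x) -> K <= K' -> sum_le g K -> sum_le f K'.
Proof.
  intros H HK Hg l Hl; specialize (Hg l Hl).
  assert (H1 := lsum_le f g l (fun x _ => H x)); lra.
Qed.

Lemma sum_le_lin {A} (a b : R) (f g : A -> R) K K' :
  0 <= a -> 0 <= b -> sum_le f K -> sum_le g K' ->
  sum_le (fun x => a * f x + b * g x) (a * K + b * K').
Proof.
  intros Ha Hb Hf Hg l Hl; rewrite lsum_lin.
  apply Rplus_le_compat; apply Rmult_le_compat_l; auto.
Qed.

Lemma sum_le_scal {A} (a : R) (f : A -> R) K :
  0 <= a -> sum_le f K -> sum_le (fun x => a * f x) (a * K).
Proof.
  intros Ha Hf l Hl; rewrite lsum_scal; apply Rmult_le_compat_l; auto.
Qed.

Lemma sum_le_inj {A B} (e : B -> A) (f : A -> R) K :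
  (forall x y, e x = e y -> x = y) -> sum_le f K -> sum_le (fun y => f (e y)) K.
Proof.
  intros He Hf l Hl; rewrite <- lsum_map; apply Hf.
  apply FinFun.Injective_map_NoDup; assumption.
Qed.

(** Tonelli for majorants: a finite set of pairs lies in the rectangle spanned by its two
    projections, and nonnegativity allows enlarging to that rectangle. *)
Lemma sum_le_prod {A B} (f : A * B -> R) (M : A -> R) K :
  (forall x, 0 <= f x) -> (forall a, sum_le (fun b => f (a, b)) (M a)) ->
  sum_le M K -> sum_le f K.
Proof.
  intros Hf HM HK l Hl.
  destruct (NoDup_superset (map fst l)) as (la & Ha1 & Ha2).
  destruct (NoDup_superset (map snd l)) as (lb & Hb1 & Hb2).
  apply Rle_trans with (lsum f (list_prod la lb)).
  - apply lsum_incl; [exact Hf|exact Hl|].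
    intros [a b] Hx; apply in_prod.
    + apply Ha2; change a with (fst (a, b)); apply in_map, Hx.
    + apply Hb2; change b with (snd (a, b)); apply in_map, Hx.
  - apply Rle_trans with (lsum M la); [|apply HK, Ha1].
    clear Ha1 Ha2; induction la as [|a la IH]; simpl; [lra|].
    rewrite lsum_app, lsum_map; apply Rplus_le_compat; [apply HM, Hb1|exact IH].
Qed.

(** * Complex families *)

Definition has_csum {A : Type} (f : A -> C) (S : C) : Prop :=
  has_sum (fun x => Re (f x)) (Re S) /\ has_sum (fun x => Im (f x)) (Im S).

Lemma C_ext (x y : C) : Re x = Re y -> Im x = Im y -> x = y.
Proof. destruct x, y; simpl; intros; subst; reflexivity. Qed.

Lemma has_csum_ext {A} (f g : A -> C) S :
  (forall x, f x = g x) -> has_csum f S -> has_csum g S.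
Proof.
  intros H [H1 H2]; split; (eapply has_sum_ext; [|eassumption]);
    intros x; simpl; rewrite H; reflexivity.
Qed.

Lemma has_csum_unique {A} (f : A -> C) S S' :
  has_csum f S -> has_csum f S' -> S = S'.
Proof. intros [] []; apply C_ext; eapply has_sum_unique; eassumption. Qed.

Lemma has_csum_plus {A} (f g : A -> C) S S' :
  has_csum f S -> has_csum g S' -> has_csum (fun x => Cplus (f x) (g x)) (Cplus S S').
Proof. intros [] []; split; simpl; apply has_sum_plus; assumption. Qed.

Lemma has_csum_scal {A} (c : C) (f : A -> C) S :
  has_csum f S -> has_csum (fun x => Cmult c (f x)) (Cmult c S).
Proof.
  intros [H1 H2]; split; simpl.
  - apply has_sum_minus; apply has_sum_scal; assumption.
  - apply has_sum_plus; apply has_sum_scal; assumption.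
Qed.

Lemma has_csum_conj {A} (f : A -> C) S :
  has_csum f S -> has_csum (fun x => Cconj (f x)) (Cconj S).
Proof.
  intros [H1 H2]; split; simpl; [exact H1|].
  replace (- snd S) with ((-1) * Im S) by (unfold Im; ring).
  apply (has_sum_ext (fun x => (-1) * Im (f x))); [intros x; unfold Im; ring|].
  apply has_sum_scal, H2.
Qed.

Lemma has_csum_reindex {A B} (e : B -> A) (e' : A -> B) (f : A -> C) S :
  (forall x, e (e' x) = x) -> (forall y, e' (e y) = y) ->
  has_csum f S -> has_csum (fun y => f (e y)) S.
Proof.
  intros He He' [H1 H2]; split.
  - apply (has_sum_reindex e e' (fun x => Re (f x))); assumption.
  - apply (has_sum_reindex e e' (fun x => Im (f x))); assumption.
Qed.

Lemma has_csum_fubini {A B} (F : A * B -> C) (g : A -> C) S :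
  has_csum F S -> (forall a, has_csum (fun b => F (a, b)) (g a)) -> has_csum g S.
Proof.
  intros [H1 H2] Hg; split.
  - apply (has_sum_fubini (fun x => Re (F x))); [exact H1|intros a; apply Hg].
  - apply (has_sum_fubini (fun x => Im (F x))); [exact H2|intros a; apply Hg].
Qed.

Lemma has_csum_ex {A} (f : A -> C) (g : A -> R) K :
  (forall x, Cmod (f x) <= g x) -> sum_le g K -> exists S, has_csum f S.
Proof.
  intros Hfg Hg.
  destruct (has_sum_abs_ex (fun x => Re (f x)) K) as [S1 H1].
  { apply (sum_le_mono _ g K); [|lra|exact Hg].
    intros x; eapply Rle_trans; [apply re_le_Cmod|apply Hfg]. }
  destruct (has_sum_abs_ex (fun x => Im (f x)) K) as [S2 H2].
  { apply (sum_le_mono _ g K); [|lra|exact Hg].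
    intros x; eapply Rle_trans; [|apply Hfg].
    eapply Rle_trans; [apply Rmax_r|apply Rmax_Cmod]. }
  exists (S1, S2); split; assumption.
Qed.

(** * Sums over Z and the L^2 norm *)

(** Follows the recursion of [zsum_aux] exactly, so both sums unfold in step. *)
Fixpoint zrange (N i : nat) : list Z :=
  match i with
  | O => nil
  | S i' => (Z.of_nat i' - Z.of_nat N)%Z :: zrange N i'
  end.

Lemma in_zrange N i x :
  In x (zrange N i) <-> (- Z.of_nat N <= x < Z.of_nat i - Z.of_nat N)%Z.
Proof.
  induction i as [|i IH]; simpl zrange; simpl In; [lia|].
  rewrite IH; lia.
Qed.

Lemma NoDup_zrange N i : NoDup (zrange N i).
Proof.
  induction i as [|i IH]; simpl; constructor; [|exact IH].
  rewrite in_zrange; lia.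
Qed.

Lemma zsum_aux_lsum g N i :
  zsum_aux g N i = (lsum (fun x => Re (g x)) (zrange N i), lsum (fun x => Im (g x)) (zrange N i)).
Proof. induction i as [|i IH]; simpl; [|rewrite IH]; reflexivity. Qed.

Definition zbox_list (N : nat) : list Z := zrange N (2 * N + 1).

Lemma in_zbox_list N x : In x (zbox_list N) <-> (Z.abs x <= Z.of_nat N)%Z.
Proof. unfold zbox_list; rewrite in_zrange; lia. Qed.

Lemma list_Z_bounded (l : list Z) :
  exists N0, forall N x, (N0 <= N)%nat -> In x l -> (Z.abs x <= Z.of_nat N)%Z.
Proof.
  induction l as [|y l [N0 IH]].
  - exists O; intros N x _ [].
  - exists (N0 + Z.abs_nat y)%nat; intros N x HN [->|Hx].
    + lia.
    + apply IH; [lia|exact Hx].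
Qed.

Lemma has_sum_lim {A} (f : A -> R) S (L : nat -> list A) :
  (forall N, NoDup (L N)) ->
  (forall l, exists N0, forall N, (N0 <= N)%nat -> incl l (L N)) ->
  has_sum f S -> is_lim_seq (fun N => lsum f (L N)) S.
Proof.
  intros Hnd Hex Hf; apply is_lim_seq_spec; intros eps.
  destruct (Hf (eps / 2)) as [l0 H0]; [destruct eps; simpl; lra|].
  destruct (Hex l0) as [N0 HN0]; exists N0; intros N HN.
  specialize (H0 (L N) (Hnd N) (HN0 N HN)); destruct eps; simpl in *; lra.
Qed.

(** [climit] has a value even for a divergent sequence, so [zsum] is evaluated only through an
    unconditional sum. The symmetric boxes eventually contain every finite set of frequencies. *)
Lemma zsum_has_csum g S : has_csum g S -> zsum g = S.
Proof.
  intros [H1 H2].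
  assert (Hex : forall l, exists N0, forall N, (N0 <= N)%nat -> incl l (zbox_list N)).
  { intros l; destruct (list_Z_bounded l) as [N0 H]; exists N0.
    intros N HN x Hx; apply in_zbox_list, H; assumption. }
  apply (has_sum_lim _ _ zbox_list) in H1; [|intros; apply NoDup_zrange|exact Hex].
  apply (has_sum_lim _ _ zbox_list) in H2; [|intros; apply NoDup_zrange|exact Hex].
  apply C_ext; unfold zsum, climit; simpl.
  - erewrite Lim_seq_ext; [rewrite (is_lim_seq_unique _ _ H1); reflexivity|].
    intros N; unfold zbox; rewrite zsum_aux_lsum; reflexivity.
  - erewrite Lim_seq_ext; [rewrite (is_lim_seq_unique _ _ H2); reflexivity|].
    intros N; unfold zbox; rewrite zsum_aux_lsum; reflexivity.
Qed.

Lemma lsum_list_prod {A B} (f : A * B -> R) la lb :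
  lsum f (list_prod la lb) = lsum (fun a => lsum (fun b => f (a, b)) lb) la.
Proof.
  induction la as [|a la IH]; simpl; [reflexivity|].
  rewrite lsum_app, lsum_map, IH; reflexivity.
Qed.

Lemma NoDup_list_prod {A B} (la : list A) (lb : list B) :
  NoDup la -> NoDup lb -> NoDup (list_prod la lb).
Proof.
  intros Ha Hb; induction Ha as [|a la Hn Ha IH]; simpl; [constructor|].
  apply NoDup_app; [|exact IH|].
  - apply FinFun.Injective_map_NoDup; [intros x y H; injection H; auto|exact Hb].
  - intros [a' b] H1 H2; apply in_map_iff in H1; destruct H1 as (b' & H1 & _).
    injection H1; intros; subst; apply in_prod_iff in H2; tauto.
Qed.

Lemma zsum2_has_csum g S : has_csum (fun x : Z * Z => g (fst x) (snd x)) S -> zsum2 g = S.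
Proof.
  intros [H1 H2].
  pose (L := fun N => list_prod (zbox_list N) (zbox_list N)).
  assert (HL : forall N, NoDup (L N)) by (intros; apply NoDup_list_prod; apply NoDup_zrange).
  assert (Hex : forall l, exists N0, forall N, (N0 <= N)%nat -> incl l (L N)).
  { intros l; destruct (list_Z_bounded (map fst l)) as [N0 H].
    destruct (list_Z_bounded (map snd l)) as [N1 H'].
    exists (N0 + N1)%nat; intros N HN [x y] Hx; apply in_prod; apply in_zbox_list.
    - apply H; [lia|change x with (fst (x, y)); apply in_map, Hx].
    - apply H'; [lia|change y with (snd (x, y)); apply in_map, Hx]. }
  apply (has_sum_lim _ _ L) in H1; [|exact HL|exact Hex].
  apply (has_sum_lim _ _ L) in H2; [|exact HL|exact Hex].
  apply C_ext; unfold zsum2, climit; simpl.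
  - erewrite Lim_seq_ext; [rewrite (is_lim_seq_unique _ _ H1); reflexivity|].
    intros N; unfold zbox, L; rewrite zsum_aux_lsum, lsum_list_prod; simpl.
    apply lsum_ext_in; intros x _; rewrite zsum_aux_lsum; reflexivity.
  - erewrite Lim_seq_ext; [rewrite (is_lim_seq_unique _ _ H2); reflexivity|].
    intros N; unfold zbox, L; rewrite zsum_aux_lsum, lsum_list_prod; simpl.
    apply lsum_ext_in; intros x _; rewrite zsum_aux_lsum; reflexivity.
Qed.

(** Groups the frequencies in pairs as [sq_term] does, which ties the series over [nat] to finite
    sums over [Z]. *)
Fixpoint sym_list (N : nat) : list Z :=
  match N with
  | O => 0%Z :: nil
  | S n => Z.of_nat (S n) :: (- Z.of_nat (S n))%Z :: sym_list n
  end.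

Lemma in_sym_list N x : In x (sym_list N) <-> (Z.abs x <= Z.of_nat N)%Z.
Proof.
  induction N as [|N IH]; [simpl; lia|].
  change (In x (sym_list (S N))) with
    (Z.of_nat (S N) = x \/ (- Z.of_nat (S N))%Z = x \/ In x (sym_list N)).
  rewrite IH; lia.
Qed.

Lemma NoDup_sym_list N : NoDup (sym_list N).
Proof.
  induction N as [|N IH].
  - constructor; [intros []|constructor].
  - change (NoDup (Z.of_nat (S N) :: (- Z.of_nat (S N))%Z :: sym_list N)).
    constructor; [|constructor; [|exact IH]].
    + intros [H|H]; [lia|apply in_sym_list in H; lia].
    + intros H; apply in_sym_list in H; lia.
Qed.

Lemma sym_list_exhausts l : exists N0, forall N, (N0 <= N)%nat -> incl l (sym_list N).
Proof.
  destruct (list_Z_bounded l) as [N0 H]; exists N0.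
  intros N HN x Hx; apply in_sym_list, H; assumption.
Qed.

Lemma sum_le_sym (a : Z -> R) K :
  (forall k, 0 <= a k) -> (forall N, lsum a (sym_list N) <= K) -> sum_le a K.
Proof.
  intros Ha HK l Hl; destruct (sym_list_exhausts l) as [N0 H].
  apply Rle_trans with (lsum a (sym_list N0)); [|apply HK].
  apply lsum_incl; [exact Ha|exact Hl|apply H; lia].
Qed.

(** The shift comes from [sq_term f n] holding the frequencies n+1 and -(n+1): the partial sum of
    index [N] reaches frequency N+1. *)
Lemma lsum_sq_term (f : fourier) N :
  lsum (fun k => Cmod (f k) ^ 2) (sym_list (S N)) =
  Cmod (f 0%Z) ^ 2 + sum_n (sq_term f) N.
Proof.
  induction N as [|N IH].
  - rewrite sum_O; unfold sq_term; simpl; ring.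
  - rewrite sum_Sn.
    change (lsum (fun k => Cmod (f k) ^ 2) (sym_list (S (S N)))) with
      (Cmod (f (Z.of_nat (S (S N)))) ^ 2 + (Cmod (f (- Z.of_nat (S (S N)))%Z) ^ 2 +
         lsum (fun k => Cmod (f k) ^ 2) (sym_list (S N)))).
    rewrite IH; change plus with Rplus; unfold sq_term; ring.
Qed.

Lemma sq_summable_L2norm2 (f : fourier) :
  ex_series (sq_term f) ->
  exists S, has_sum (fun k => Cmod (f k) ^ 2) S /\ L2norm2 f = 2 * PI * S.
Proof.
  intros [s Hs].
  assert (Hlim : is_lim_seq (fun N => lsum (fun k => Cmod (f k) ^ 2) (sym_list (S N)))
                   (Cmod (f 0%Z) ^ 2 + s)).
  { apply is_lim_seq_ext with (fun N => Cmod (f 0%Z) ^ 2 + sum_n (sq_term f) N).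
    - intros N; symmetry; apply lsum_sq_term.
    - apply is_lim_seq_plus'; [apply is_lim_seq_const|exact Hs]. }
  assert (Hpos : forall k, 0 <= Cmod (f k) ^ 2) by (intros; apply pow2_ge_0).
  destruct (has_sum_nonneg_ex (fun k => Cmod (f k) ^ 2) (Cmod (f 0%Z) ^ 2 + s) Hpos)
    as [S HS].
  { apply sum_le_sym; [exact Hpos|]; intros N.
    apply Rle_trans with (lsum (fun k => Cmod (f k) ^ 2) (sym_list (S N))).
    - apply lsum_incl; [exact Hpos|apply NoDup_sym_list|].
      intros x Hx; apply in_sym_list in Hx; apply in_sym_list; lia.
    - apply (is_lim_seq_incr_compare _ _ Hlim).
      intros n; apply lsum_incl; [exact Hpos|apply NoDup_sym_list|].
      intros x Hx; apply in_sym_list in Hx; apply in_sym_list; lia. }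
  exists S; split; [exact HS|].
  unfold L2norm2; rewrite (is_series_unique _ _ Hs).
  replace S with (Cmod (f 0%Z) ^ 2 + s); [reflexivity|].
  assert (H := has_sum_lim _ _ sym_list NoDup_sym_list sym_list_exhausts HS).
  apply is_lim_seq_incr_1 in H; apply is_lim_seq_unique in H; apply is_lim_seq_unique in Hlim.
  rewrite H in Hlim; injection Hlim; auto.
Qed.

(** * Square-summable frequency weights *)

Definition wt (k : Z) : R := if Z.eq_dec k 0 then 1 else / Rabs (IZR k).

Lemma IZR_abs_ge1 k : k <> 0%Z -> 1 <= Rabs (IZR k).
Proof. intros H; rewrite <- abs_IZR; apply IZR_le; lia. Qed.

Lemma wt_pos k : 0 < wt k.
Proof.
  unfold wt; destruct (Z.eq_dec k 0) as [|n]; [lra|].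
  apply Rinv_0_lt_compat; assert (H := IZR_abs_ge1 k n); lra.
Qed.

(** The bound is 1 at the origin plus twice the estimate 2 for the sum of 1/n^2. The term -2/(n+1)
    in the induction makes it telescope through 1/(n+2)^2 <= 1/(n+1) - 1/(n+2). *)
Lemma sum_le_wt2 : sum_le (fun k => wt k ^ 2) 5.
Proof.
  assert (Hw : forall n, wt (Z.of_nat (S n)) ^ 2 = / (INR n + 1) ^ 2 /\
                         wt (- Z.of_nat (S n)) ^ 2 = / (INR n + 1) ^ 2).
  { intros n; unfold wt.
    destruct (Z.eq_dec (Z.of_nat (S n)) 0); [lia|].
    destruct (Z.eq_dec (- Z.of_nat (S n)) 0); [lia|].
    rewrite opp_IZR, Rabs_Ropp, <- INR_IZR_INZ, S_INR.
    assert (H := pos_INR n); rewrite Rabs_pos_eq by lra.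
    split; field; lra. }
  assert (H : forall n, lsum (fun k => wt k ^ 2) (sym_list (S n)) <= 5 - 2 / (INR n + 1)).
  { induction n as [|n IH].
    - unfold sym_list, lsum; destruct (Hw O) as [-> ->].
      simpl; unfold wt; destruct Z.eq_dec; [|lia]; lra.
    - change (lsum (fun k => wt k ^ 2) (sym_list (S (S n)))) with
        (wt (Z.of_nat (S (S n))) ^ 2 + (wt (- Z.of_nat (S (S n)))%Z ^ 2 +
           lsum (fun k => wt k ^ 2) (sym_list (S n)))).
      destruct (Hw (S n)) as [-> ->].
      rewrite S_INR; assert (Hn := pos_INR n); set (x := INR n) in *.
      assert (/ (x + 1 + 1) ^ 2 <= / (x + 1) - / (x + 1 + 1)); [|unfold Rdiv in *; lra].
      replace (/ (x + 1) - / (x + 1 + 1)) with (/ ((x + 1) * (x + 1 + 1))) by (field; lra).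
      apply Rinv_le_contravar; nra. }
  apply sum_le_sym; [intros; apply pow2_ge_0|].
  intros N; apply Rle_trans with (lsum (fun k => wt k ^ 2) (sym_list (S N))).
  - apply lsum_incl; [intros; apply pow2_ge_0|apply NoDup_sym_list|].
    intros x Hx; apply in_sym_list in Hx; apply in_sym_list; lia.
  - eapply Rle_trans; [apply H|].
    assert (Hn := pos_INR N); assert (0 < 2 / (INR N + 1)) by (apply Rdiv_lt_0_compat; lra); lra.
Qed.

(** * Oscillatory integrals *)

Lemma cexpi_plus x y : cexpi (x + y) = Cmult (cexpi x) (cexpi y).
Proof. unfold cexpi; rewrite cos_plus, sin_plus; apply C_ext; simpl; ring. Qed.

Lemma cexpi_0 : cexpi 0 = RtoC 1.
Proof. unfold cexpi; rewrite cos_0, sin_0; reflexivity. Qed.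

Lemma Cmod_cexpi x : Cmod (cexpi x) = 1.
Proof.
  unfold cexpi, Cmod; simpl; rewrite !Rmult_1_r.
  rewrite <- sqrt_1; f_equal; assert (H := sin2_cos2 x); unfold Rsqr in H; lra.
Qed.

(* [int_s^t e^{-i a x} dx] *)
Definition Eint (a s t : R) : C :=
  if Req_dec_T a 0 then RtoC (t - s)
  else Cdiv (Cminus (cexpi (- a * s)) (cexpi (- a * t))) (Cmult Ci (RtoC a)).

Lemma Eint_0 s t : Eint 0 s t = RtoC (t - s).
Proof. unfold Eint; destruct Req_dec_T; [reflexivity|lra]. Qed.

Lemma Eint_neq0 a s t : a <> 0 ->
  Eint a s t = Cdiv (Cminus (cexpi (- a * s)) (cexpi (- a * t))) (Cmult Ci (RtoC a)).
Proof. intros H; unfold Eint; destruct Req_dec_T; [lra|reflexivity]. Qed.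

Lemma RtoC_neq0 (a : R) : a <> 0 -> RtoC a <> RtoC 0.
Proof. intros H E; apply H; injection E; auto. Qed.

Lemma Ci_neq0 : Ci <> RtoC 0.
Proof. intros E; injection E; lra. Qed.

Lemma Cmod_Ci_mult x : Cmod (Cmult Ci x) = Cmod x.
Proof.
  rewrite Cmod_mult; replace (Cmod Ci) with 1; [ring|].
  unfold Cmod, Ci; simpl; rewrite <- sqrt_1 at 1; f_equal; ring.
Qed.

Lemma Cmod_minus_le x y : Cmod (Cminus x y) <= Cmod x + Cmod y.
Proof. unfold Cminus; rewrite <- (Cmod_opp y); apply Cmod_triangle. Qed.

Lemma Eint_bound a s t : a <> 0 -> Cmod (Eint a s t) <= 2 / Rabs a.
Proof.
  intros H; rewrite Eint_neq0 by exact H.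
  rewrite Cmod_div by (apply Cmult_neq_0; [apply Ci_neq0|apply RtoC_neq0, H]).
  rewrite Cmod_Ci_mult, Cmod_R.
  apply Rmult_le_compat_r; [left; apply Rinv_0_lt_compat, Rabs_pos_lt, H|].
  eapply Rle_trans; [apply Cmod_minus_le|]; rewrite !Cmod_cexpi; lra.
Qed.

Lemma Eint_conj a s t : Cconj (Eint a s t) = Eint (- a) s t.
Proof.
  destruct (Req_dec_T a 0) as [->|H].
  - rewrite Ropp_0, !Eint_0; apply C_ext; simpl; ring.
  - rewrite !Eint_neq0 by lra.
    unfold cexpi.
    replace (- - a * s) with (- (- a * s)) by ring.
    replace (- - a * t) with (- (- a * t)) by ring.
    rewrite !cos_neg, !sin_neg; apply C_ext; simpl; field; lra.
Qed.

Lemma Eint_components a s t :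
  is_RInt (fun x => cos (a * x)) s t (Re (Eint a s t)) /\
  is_RInt (fun x => sin (a * x)) s t (- Im (Eint a s t)).
Proof.
  destruct (Req_dec_T a 0) as [->|H].
  - rewrite Eint_0; simpl; split.
    + apply is_RInt_ext with (fun _ => 1).
      { intros; rewrite Rmult_0_l, cos_0; reflexivity. }
      replace (t - s) with (scal (t - s) 1) by (unfold scal; simpl; unfold mult; simpl; ring).
      apply (is_RInt_const (V := R_NormedModule)).
    + apply is_RInt_ext with (fun _ => 0).
      { intros; rewrite Rmult_0_l, sin_0; reflexivity. }
      replace (- 0) with (scal (t - s) 0) by (unfold scal; simpl; unfold mult; simpl; ring).
      apply (is_RInt_const (V := R_NormedModule)).
  - rewrite Eint_neq0 by exact H.
    replace (- a * s) with (- (a * s)) by ring; replace (- a * t) with (- (a * t)) by ring.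
    unfold cexpi; rewrite !cos_neg, !sin_neg; split.
    + match goal with |- is_RInt _ _ _ ?v =>
        replace v with (minus (sin (a * t) / a) (sin (a * s) / a)) end.
      * apply (is_RInt_derive (fun x => sin (a * x) / a)).
        -- intros x _; auto_derive; [trivial|field; exact H].
        -- intros x _; apply (ex_derive_continuous (K := R_AbsRing) (V := R_NormedModule)).
           auto_derive; trivial.
      * unfold minus, plus, opp; simpl; field; exact H.
    + match goal with |- is_RInt _ _ _ ?v =>
        replace v with (minus (- cos (a * t) / a) (- cos (a * s) / a)) end.
      * apply (is_RInt_derive (fun x => - cos (a * x) / a)).
        -- intros x _; auto_derive; [trivial|field; exact H].
        -- intros x _; apply (ex_derive_continuous (K := R_AbsRing) (V := R_NormedModule)).
           auto_derive; trivial.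
      * unfold minus, plus, opp; simpl; field; exact H.
Qed.

(** Only the inner integration divides by a frequency, namely b. The outer one is left inside
    [Eint], so the resonances a = 0 and a + b = 0 need no separate case. *)
Lemma Jint_closed a b s t : b <> 0 ->
  Jint a b s t =
  Cdiv (Cminus (Cmult (cexpi (- b * s)) (Eint a s t)) (Eint (a + b) s t))
       (Cmult Ci (RtoC b)).
Proof.
  intros Hb.
  assert (Hin1 : forall x, RInt (fun y => cos (a * x + b * y)) s x =
                           (sin ((a + b) * x) - sin (a * x + b * s)) / b).
  { intros x; apply is_RInt_unique.
    replace ((sin ((a + b) * x) - sin (a * x + b * s)) / b) with
      (minus (sin (a * x + b * x) / b) (sin (a * x + b * s) / b)).
    - apply (is_RInt_derive (fun y => sin (a * x + b * y) / b)).
      + intros y _; auto_derive; [trivial|field; exact Hb].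
      + intros y _; apply (ex_derive_continuous (K := R_AbsRing) (V := R_NormedModule)).
        auto_derive; trivial.
    - unfold minus, plus, opp; simpl; rewrite Rmult_plus_distr_r; field; exact Hb. }
  assert (Hin2 : forall x, RInt (fun y => sin (a * x + b * y)) s x =
                           (cos (a * x + b * s) - cos ((a + b) * x)) / b).
  { intros x; apply is_RInt_unique.
    replace ((cos (a * x + b * s) - cos ((a + b) * x)) / b) with
      (minus (- cos (a * x + b * x) / b) (- cos (a * x + b * s) / b)).
    - apply (is_RInt_derive (fun y => - cos (a * x + b * y) / b)).
      + intros y _; auto_derive; [trivial|field; exact Hb].
      + intros y _; apply (ex_derive_continuous (K := R_AbsRing) (V := R_NormedModule)).
        auto_derive; trivial.
    - unfold minus, plus, opp; simpl; rewrite Rmult_plus_distr_r; field; exact Hb. }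
  destruct (Eint_components a s t) as [Hc Hs].
  destruct (Eint_components (a + b) s t) as [Hc' Hs'].
  set (E := Eint a s t) in *; set (E' := Eint (a + b) s t) in *.
  assert (Hre : RInt (fun x => RInt (fun y => cos (a * x + b * y)) s x) s t =
    / b * (- Im E' - (cos (b * s) * - Im E + sin (b * s) * Re E))).
  { apply is_RInt_unique.
    apply is_RInt_ext with (fun x => scal (/ b) (minus (sin ((a + b) * x))
      (plus (scal (cos (b * s)) (sin (a * x))) (scal (sin (b * s)) (cos (a * x)))))).
    - intros x _; rewrite Hin1, sin_plus.
      unfold scal, minus, plus, opp; simpl; unfold mult; simpl; field; exact Hb.
    - apply (is_RInt_scal (V := R_NormedModule)), (is_RInt_minus (V := R_NormedModule)); [exact Hs'|].
      apply (is_RInt_plus (V := R_NormedModule)); apply (is_RInt_scal (V := R_NormedModule)); assumption. }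
  assert (Him : RInt (fun x => RInt (fun y => sin (a * x + b * y)) s x) s t =
    / b * (cos (b * s) * Re E - sin (b * s) * - Im E - Re E')).
  { apply is_RInt_unique.
    apply is_RInt_ext with (fun x => scal (/ b) (minus
      (minus (scal (cos (b * s)) (cos (a * x))) (scal (sin (b * s)) (sin (a * x))))
      (cos ((a + b) * x)))).
    - intros x _; rewrite Hin2, cos_plus.
      unfold scal, minus, plus, opp; simpl; unfold mult; simpl; field; exact Hb.
    - apply (is_RInt_scal (V := R_NormedModule)), (is_RInt_minus (V := R_NormedModule)); [|exact Hc'].
      apply (is_RInt_minus (V := R_NormedModule)); apply (is_RInt_scal (V := R_NormedModule)); assumption. }
  unfold Jint; rewrite Hre, Him.
  replace (- b * s) with (- (b * s)) by ring; unfold cexpi; rewrite cos_neg, sin_neg.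
  destruct E as [e1 e2], E' as [f1 f2]; apply C_ext; simpl; field; exact Hb.
Qed.

Lemma Jint_bound a b s t : b <> 0 ->
  Cmod (Jint a b s t) <= (Cmod (Eint a s t) + Cmod (Eint (a + b) s t)) / Rabs b.
Proof.
  intros Hb; rewrite Jint_closed by exact Hb.
  rewrite Cmod_div by (apply Cmult_neq_0; [apply Ci_neq0|apply RtoC_neq0, Hb]).
  rewrite Cmod_Ci_mult, Cmod_R.
  apply Rmult_le_compat_r; [left; apply Rinv_0_lt_compat, Rabs_pos_lt, Hb|].
  eapply Rle_trans; [apply Cmod_minus_le|]; rewrite Cmod_mult, Cmod_cexpi; lra.
Qed.

(* The two integration triangles fill the square [s,t]^2. *)
Lemma Jint_sym a b s t : a <> 0 -> b <> 0 ->
  Cplus (Jint a b s t) (Jint b a s t) = Cmult (Eint a s t) (Eint b s t).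
Proof.
  intros Ha Hb; rewrite !Jint_closed by assumption; rewrite (Rplus_comm b a).
  assert (Ha' := RtoC_neq0 a Ha); assert (Hb' := RtoC_neq0 b Hb).
  assert (Hi := Ci_neq0).
  destruct (Req_dec_T (a + b) 0) as [H0|H0].
  (* In the resonant case the two contributions of t - s carry the factors 1/a and 1/b = -1/a and
     cancel. What remains is the replacement of [x * x'] by [y * y'], both products of opposite
     phases and hence 1. *)
  - replace b with (- a) in * by lra; rewrite Rplus_opp_r, Eint_0, !Eint_neq0 by lra.
    replace (- - a * s) with (- (- a * s)) by ring.
    replace (- - a * t) with (- (- a * t)) by ring.
    assert (Hs : Cmult (cexpi (- a * s)) (cexpi (- (- a * s))) = RtoC 1)
      by (rewrite <- cexpi_plus, Rplus_opp_r; apply cexpi_0).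
    assert (Ht : Cmult (cexpi (- a * t)) (cexpi (- (- a * t))) = RtoC 1)
      by (rewrite <- cexpi_plus, Rplus_opp_r; apply cexpi_0).
    set (x := cexpi (- a * s)) in *; set (x' := cexpi (- (- a * s))) in *.
    set (y := cexpi (- a * t)) in *; set (y' := cexpi (- (- a * t))) in *.
    rewrite RtoC_opp in *.
    transitivity (Cdiv (Cminus (Cplus (Cmult x x') (Cmult x x')) (Cplus (Cmult x' y) (Cmult x y'))) (RtoC a * RtoC a))%C.
    { apply C_ext; destruct x, x', y, y'; simpl; field; exact Ha. }
    transitivity (Cdiv (Cminus (Cplus (Cmult x x') (Cmult y y')) (Cplus (Cmult x' y) (Cmult x y'))) (RtoC a * RtoC a))%C.
    { rewrite Hs, Ht; reflexivity. }
    apply C_ext; destruct x, x', y, y'; simpl; field; exact Ha.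
  - rewrite !Eint_neq0 by assumption.
    replace (- (a + b) * s) with (- a * s + - b * s) by ring.
    replace (- (a + b) * t) with (- a * t + - b * t) by ring.
    rewrite !cexpi_plus; assert (H0' := RtoC_neq0 _ H0); rewrite RtoC_plus in *.
    field; repeat split; assumption.
Qed.

(** * The KdV operators on a fixed element of L^2_0 *)

(** From ab <= (a^2 + b^2)/2. Its main use is with [b] = [wt]: a square-summable sequence becomes
    summable once multiplied by a weight, even a shifted one. *)
Lemma sum_le_mul_shift (a b : Z -> R) K K' (e : Z -> Z) :
  (forall x y, e x = e y -> x = y) ->
  sum_le (fun k => a k ^ 2) K -> sum_le (fun k => b k ^ 2) K' ->
  sum_le (fun k => a k * b (e k)) ((K + K') / 2).
Proof.
  intros He Ha Hb.
  apply (sum_le_mono _ (fun k => / 2 * a k ^ 2 + / 2 * b (e k) ^ 2) (/ 2 * K + / 2 * K')).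
  - intros k; assert (H := pow2_ge_0 (a k - b (e k))); nra.
  - lra.
  - apply sum_le_lin; [lra|lra|exact Ha|].
    apply (sum_le_inj e (fun k => b k ^ 2)); assumption.
Qed.

(** * A summable majorant for the quartic form *)

Definition delta (k : Z) : R := if Z.eq_dec k 0 then 1 else 0.

Lemma delta_ge0 k : 0 <= delta k.
Proof. unfold delta; destruct Z.eq_dec; lra. Qed.

Lemma sum_le_delta (c : Z) (x : R) : 0 <= x -> sum_le (fun k => delta (k + c) * x) x.
Proof.
  intros Hx l Hl.
  assert (H : (In (- c)%Z l -> lsum (fun k => delta (k + c) * x) l = x) /\
              (~ In (- c)%Z l -> lsum (fun k => delta (k + c) * x) l = 0)).
  { induction Hl as [|k l Hk Hl [IH1 IH2]]; simpl; [tauto|].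
    unfold delta at 1 3; destruct (Z.eq_dec (k + c) 0) as [E|E].
    - assert (k = (- c)%Z) by lia; subst k.
      split; [intros _; rewrite IH2 by exact Hk; ring|tauto].
    - split.
      + intros [->|H]; [lia|]; rewrite IH1 by exact H; ring.
      + intros H; rewrite IH2 by tauto; ring. }
  destruct (classic (In (- c)%Z l)) as [Hi|Hi];
    [rewrite (proj1 H Hi)|rewrite (proj2 H Hi)]; lra.
Qed.

Lemma sum_le_point {A} (f : A -> R) K x : sum_le f K -> f x <= K.
Proof.
  intros H; assert (H1 := H (x :: nil)); simpl in H1; rewrite Rplus_0_r in H1.
  apply H1; constructor; [intros []|constructor].
Qed.

Lemma sum_le_ext {A} (f g : A -> R) K :
  (forall x, f x = g x) -> sum_le f K -> sum_le g K.
Proof. intros H Hf l Hl; rewrite <- (lsum_ext_in f g) by auto; auto. Qed.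

(** Here [a] stands for the moduli of the coefficients, and the fourth frequency is forced by the
    zero-sum constraint. The [delta] terms sit on the resonances q = -m and q = -n, where the
    integral with vanishing phase has size [D] = |t-s|. *)
Definition quartic_dom (D : R) (a : Z -> R) (m n q : Z) : R :=
  a m * a n * a q * a (q + m + n)%Z *
  (2 * (wt m * wt n) + wt m * wt (n + m) * wt (q + m) +
   D * delta (q + m) + D * delta (q + n)).

(** In the first term two weights make the sums over m and n converge, and the remaining two factors
    are paired in q by square summability. In the second, three weights handle m, n and q, and the
    last factor is bounded by its supremum. On a resonance q is determined, and evenness of [a]
    leaves a(m)^2 a(n)^2. *)
Lemma sum_le_quartic_dom D (a : Z -> R) K :
  0 <= D -> (forall k, 0 <= a k) -> (forall k, a (- k)%Z = a k) ->
  sum_le (fun k => a k ^ 2) K ->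
  exists K', sum_le (fun x : Z * (Z * Z) => quartic_dom D a (fst x) (fst (snd x)) (snd (snd x))) K'.
Proof.
  intros HD Ha Hev HK.
  assert (HK0 : 0 <= K) by (apply (HK nil); constructor).
  set (B := (K + 5) / 2).
  assert (Hw := fun k => Rlt_le _ _ (wt_pos k)).
  assert (Hd := delta_ge0).
  assert (Hb0 : sum_le (fun k => a k * wt k) B)
    by (apply (sum_le_mul_shift a wt K 5 (fun k => k)); [auto|exact HK|apply sum_le_wt2]).
  assert (Hb : forall c, sum_le (fun k => a k * wt (k + c)) B)
    by (intros c; apply (sum_le_mul_shift a wt K 5 (fun k => (k + c)%Z));
        [intros; lia|exact HK|apply sum_le_wt2]).
  assert (Haa : forall c, sum_le (fun k => a k * a (k + c)%Z) K)
    by (intros c; replace K with ((K + K) / 2) by field;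
        apply (sum_le_mul_shift a a K K (fun k => (k + c)%Z)); [intros; lia|exact HK|exact HK]).
  assert (HA : forall k, a k <= 1 + K).
  { intros k; assert (H := sum_le_point _ _ k HK); simpl in H.
    assert (H1 := pow2_ge_0 (a k - 1)); nra. }
  pose (G1 := fun x : Z * (Z * Z) => let '(m, (n, q)) := x in
    (a m * wt m) * ((a n * wt n) * (a q * a (q + (m + n))%Z))).
  pose (G2 := fun x : Z * (Z * Z) => let '(m, (n, q)) := x in
    (a m * wt m) * ((a n * wt (n + m)) * ((1 + K) * (a q * wt (q + m))))).
  pose (G3 := fun x : Z * (Z * Z) => let '(m, (n, q)) := x in
    delta (q + m) * (a m ^ 2 * a n ^ 2)).
  pose (G4 := fun x : Z * (Z * Z) => let '(m, (n, q)) := x in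
    delta (q + n) * (a m ^ 2 * a n ^ 2)).
  assert (H1 : sum_le G1 (B * (B * K))).
  { apply (sum_le_prod G1 (fun m => a m * wt m * (B * K))).
    - intros [m [n q]]; simpl; repeat apply Rmult_le_pos; auto.
    - intros m; simpl.
      eapply sum_le_ext; [|apply (sum_le_scal (a m * wt m)
        (fun b : Z * Z => a (fst b) * wt (fst b) * (a (snd b) * a (snd b + (m + fst b))%Z)))].
      + intros [n q]; reflexivity.
      + apply Rmult_le_pos; auto.
      + apply (sum_le_prod _ (fun n => a n * wt n * K)).
        * intros [n q]; simpl; repeat apply Rmult_le_pos; auto.
        * intros n; simpl; apply sum_le_scal; [apply Rmult_le_pos; auto|apply Haa].
        * eapply sum_le_ext; [|rewrite Rmult_comm; apply (sum_le_scal K), Hb0]; [|exact HK0].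
          intros; simpl; ring.
    - eapply sum_le_ext; [|rewrite Rmult_comm; apply (sum_le_scal (B * K)), Hb0].
      + intros; simpl; ring.
      + unfold B; nra. }
  assert (H2 : sum_le G2 (B * (B * ((1 + K) * B)))).
  { apply (sum_le_prod G2 (fun m => a m * wt m * (B * ((1 + K) * B)))).
    - intros [m [n q]]; simpl; repeat apply Rmult_le_pos; auto; lra.
    - intros m; simpl.
      eapply sum_le_ext; [|apply (sum_le_scal (a m * wt m)
        (fun b : Z * Z => a (fst b) * wt (fst b + m) * ((1 + K) * (a (snd b) * wt (snd b + m)))))].
      + intros [n q]; reflexivity.
      + apply Rmult_le_pos; auto.
      + apply (sum_le_prod _ (fun n => a n * wt (n + m) * ((1 + K) * B))).
        * intros [n q]; simpl; repeat apply Rmult_le_pos; auto; lra.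
        * intros n; simpl; apply sum_le_scal; [apply Rmult_le_pos; auto|].
          apply sum_le_scal; [lra|apply Hb].
        * eapply sum_le_ext; [|rewrite Rmult_comm; apply (sum_le_scal ((1 + K) * B)), (Hb m)].
          -- intros; simpl; ring.
          -- unfold B; nra.
    - eapply sum_le_ext; [|rewrite Rmult_comm; apply (sum_le_scal (B * ((1 + K) * B))), Hb0].
      + intros; simpl; ring.
      + unfold B; assert (0 <= (1 + K) * ((K + 5) / 2)) by nra; nra. }
  assert (Hsq : sum_le (fun m => a m ^ 2 * K) (K * K)).
  { eapply sum_le_ext; [|apply (sum_le_scal K), HK; exact HK0].
    intros; simpl; ring. }
  assert (Hp2 : forall k, 0 <= a k ^ 2) by (intros; apply pow2_ge_0).
  assert (Hsq' : forall m, sum_le (fun n => a m ^ 2 * a n ^ 2) (a m ^ 2 * K))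
    by (intros m; apply sum_le_scal; [apply Hp2|exact HK]).
  assert (H3 : sum_le G3 (K * K)).
  { apply (sum_le_prod G3 (fun m => a m ^ 2 * K)); [|intros m|exact Hsq].
    - intros [m [n q]]; unfold G3; apply Rmult_le_pos; [apply Hd|apply Rmult_le_pos; apply Hp2].
    - apply (sum_le_prod _ (fun n => a m ^ 2 * a n ^ 2)); [| |apply Hsq'].
      + intros [n q]; unfold G3; apply Rmult_le_pos; [apply Hd|apply Rmult_le_pos; apply Hp2].
      + intros n; unfold G3; apply sum_le_delta, Rmult_le_pos; apply Hp2. }
  assert (H4 : sum_le G4 (K * K)).
  { apply (sum_le_prod G4 (fun m => a m ^ 2 * K)); [|intros m|exact Hsq].
    - intros [m [n q]]; unfold G4; apply Rmult_le_pos; [apply Hd|apply Rmult_le_pos; apply Hp2].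
    - apply (sum_le_prod _ (fun n => a m ^ 2 * a n ^ 2)); [| |apply Hsq'].
      + intros [n q]; unfold G4; apply Rmult_le_pos; [apply Hd|apply Rmult_le_pos; apply Hp2].
      + intros n; unfold G4; apply sum_le_delta, Rmult_le_pos; apply Hp2. }
  assert (H12 := sum_le_lin 2 1 _ _ _ _ ltac:(lra) ltac:(lra) H1 H2).
  assert (H34 := sum_le_lin D D _ _ _ _ HD HD H3 H4).
  assert (H := sum_le_lin 1 1 _ _ _ _ ltac:(lra) ltac:(lra) H12 H34).
  eexists; refine (sum_le_mono _ _ _ _ _ (Rle_refl _) H).
  intros [m [n q]]; unfold quartic_dom, G1, G2, G3, G4; simpl fst; simpl snd.
  rewrite <- (Z.add_assoc q m n).
  assert (E3 : delta (q + m) * (a m * a n * a q * a (q + (m + n))%Z) =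
               delta (q + m) * (a m ^ 2 * a n ^ 2)).
  { unfold delta; destruct Z.eq_dec as [E|]; [|ring].
    replace (q + (m + n))%Z with n by lia; replace q with (- m)%Z by lia.
    rewrite Hev; ring. }
  assert (E4 : delta (q + n) * (a m * a n * a q * a (q + (m + n))%Z) =
               delta (q + n) * (a m ^ 2 * a n ^ 2)).
  { unfold delta; destruct Z.eq_dec as [E|]; [|ring].
    replace (q + (m + n))%Z with m by lia; replace q with (- n)%Z by lia.
    rewrite Hev; ring. }
  rewrite <- E3, <- E4.
  assert (E2 : a m * wt m * (a n * wt (n + m) * (a q * wt (q + m) * a (q + (m + n))%Z)) <=
               a m * wt m * (a n * wt (n + m) * (a q * wt (q + m) * (1 + K)))).
  { repeat (apply Rmult_le_compat_l; [repeat apply Rmult_le_pos; auto|]); apply HA. }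
  lra.
Qed.

(** * The quadratic operator and its pairing *)

Definition Xterm (s t : R) (f : fourier) (j m : Z) : C :=
  Cmult (Cmult (Cmult Ci (RtoC (IZR j / 2))) (Eint (3 * IZR j * IZR m * IZR (j - m)) s t))
        (Cmult (f m) (f (j - m)%Z)).

(** The frequencies excluded in [Xop] contribute nothing to [Xterm] because f vanishes at 0. The sum
    then runs over all of [Z] and can be reindexed freely. *)
Lemma Xop_Xterm (t s : R) (f : fourier) (j : Z) S : f 0%Z = RtoC 0 ->
  has_csum (Xterm s t f j) S -> Xop t s f f j = S.
Proof.
  intros f0 H; apply zsum_has_csum.
  apply (has_csum_ext (Xterm s t f j)); [|exact H]; intros m; unfold Xterm.
  destruct (Z.eqb_spec m 0) as [->|Hm]; simpl orb; cbv beta iota zeta.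
  { rewrite f0; ring. }
  destruct (Z.eqb_spec m j) as [->|Hj]; simpl orb; cbv beta iota zeta.
  { rewrite Z.sub_diag, f0; ring. }
  assert (Hm' : IZR m <> 0) by (apply not_0_IZR; exact Hm).
  assert (Hn' : IZR (j - m) <> 0) by (apply not_0_IZR; lia).
  destruct (Z.eq_dec j 0) as [E|Hj0].
  - rewrite E; replace (3 * 0 * IZR m * IZR (0 - m)) with 0 by ring.
    replace (0 / 2) with 0 by field; rewrite !Ropp_0, !Rmult_0_l.
    unfold Cdiv, Cminus; rewrite Cplus_opp_r; ring.
  - assert (Hj' : IZR j <> 0) by (apply not_0_IZR; exact Hj0).
    rewrite Eint_neq0 by (repeat apply Rmult_integral_contrapositive_currified; lra).
    f_equal.
    set (x := cexpi _); set (y := cexpi _).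
    unfold Rdiv; rewrite !RtoC_mult, RtoC_inv by lra.
    assert (H2 := RtoC_neq0 2 ltac:(lra)); assert (H3 := RtoC_neq0 3 ltac:(lra)).
    assert (H6 : RtoC 6 = Cmult (RtoC 2) (RtoC 3)) by (rewrite <- RtoC_mult; f_equal; ring).
    rewrite H6.
    apply RtoC_neq0 in Hm'; apply RtoC_neq0 in Hn'; apply RtoC_neq0 in Hj'.
    assert (Hi := Ci_neq0); field; repeat split; assumption.
Qed.

Lemma wt_neq0 k : k <> 0%Z -> wt k = / Rabs (IZR k).
Proof. intros H; unfold wt; destruct Z.eq_dec; [contradiction|reflexivity]. Qed.

(** The derivative is paid for by the phase: with n = j - m, (|j|/2) times 2/(3|j||m||n|) is
    1/(3|m||n|). *)
Lemma Xterm_bound s t f j m : f 0%Z = RtoC 0 ->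
  Cmod (Xterm s t f j m) <= (Cmod (f m) * wt m) * (Cmod (f (j - m)%Z) * wt (j - m)).
Proof.
  intros f0; unfold Xterm; rewrite !Cmod_mult, Cmod_R.
  replace (Cmod Ci) with 1 by (rewrite <- (Cmult_1_r Ci), Cmod_Ci_mult, Cmod_1; reflexivity).
  assert (Hw := wt_pos m); assert (Hw' := wt_pos (j - m)).
  assert (Ha := Cmod_ge_0 (f m)); assert (Ha' := Cmod_ge_0 (f (j - m)%Z)).
  destruct (Z.eq_dec m 0) as [->|Hm]; [rewrite f0, Cmod_0; lra|].
  destruct (Z.eq_dec (j - m) 0) as [E|Hn]; [rewrite E, f0, Cmod_0; lra|].
  assert (Hp : 0 <= (Cmod (f m) * wt m) * (Cmod (f (j - m)%Z) * wt (j - m)))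
    by (repeat apply Rmult_le_pos; lra).
  destruct (Z.eq_dec j 0) as [E|Hj].
  { rewrite E at 1; replace (0 / 2) with 0 by field; rewrite Rabs_R0; lra. }
  rewrite !wt_neq0 in * by assumption.
  assert (Hm1 := IZR_abs_ge1 m Hm); assert (Hn1 := IZR_abs_ge1 _ Hn).
  assert (Hj1 := IZR_abs_ge1 j Hj).
  assert (HE : Cmod (Eint (3 * IZR j * IZR m * IZR (j - m)) s t) <=
               2 / (3 * Rabs (IZR j) * Rabs (IZR m) * Rabs (IZR (j - m)))).
  { eapply Rle_trans; [apply Eint_bound|].
    - repeat apply Rmult_integral_contrapositive_currified; try lra; apply not_0_IZR; assumption.
    - rewrite !Rabs_mult, (Rabs_pos_eq 3) by lra; lra. }
  replace (IZR j / 2) with (IZR j * / 2) by reflexivity.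
  rewrite Rabs_mult, (Rabs_pos_eq (/ 2)) by lra.
  set (J := Rabs (IZR j)) in *; set (M := Rabs (IZR m)) in *; set (N := Rabs (IZR (j - m))) in *.
  apply Rle_trans with (1 * (J * / 2) * (2 / (3 * J * M * N)) * (Cmod (f m) * Cmod (f (j - m)%Z))).
  - apply Rmult_le_compat_r; [nra|]; apply Rmult_le_compat_l; [lra|exact HE].
  - replace (1 * (J * / 2) * (2 / (3 * J * M * N)) * (Cmod (f m) * Cmod (f (j - m)%Z)))
      with (/ 3 * ((Cmod (f m) * / M) * (Cmod (f (j - m)%Z) * / N))) by (field; lra).
    lra.
Qed.

Lemma L20_facts f : isL20 f ->
  f 0%Z = RtoC 0 /\ (forall k, Cmod (f (- k)%Z) = Cmod (f k)) /\
  exists K, sum_le (fun k => Cmod (f k) ^ 2) K.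
Proof.
  intros (f0 & Hc & Hs); split; [exact f0|split].
  - intros k; rewrite Hc; apply Cmod_conj.
  - destruct (sq_summable_L2norm2 f Hs) as (S & HS & _); exists S.
    apply has_sum_sum_le; [intros; apply pow2_ge_0|exact HS].
Qed.

Lemma sum_le_Cmod_wt f K : sum_le (fun k => Cmod (f k) ^ 2) K ->
  sum_le (fun k => Cmod (f k) * wt k) ((K + 5) / 2).
Proof.
  intros H; apply (sum_le_mul_shift (fun k => Cmod (f k)) wt K 5 (fun k => k));
    [auto|exact H|apply sum_le_wt2].
Qed.

Lemma Xop_has_csum t s f j : isL20 f -> has_csum (Xterm s t f j) (Xop t s f f j).
Proof.
  intros Hf; destruct (L20_facts f Hf) as (f0 & Hev & K & HK).
  assert (Hb := sum_le_Cmod_wt f K HK).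
  assert (Hb0 : forall k, 0 <= Cmod (f k) * wt k)
    by (intros k; apply Rmult_le_pos; [apply Cmod_ge_0|left; apply wt_pos]).
  destruct (has_csum_ex (Xterm s t f j) (fun m => (K + 5) / 2 * (Cmod (f m) * wt m))
    ((K + 5) / 2 * ((K + 5) / 2))) as [S HS].
  - intros m; eapply Rle_trans; [apply Xterm_bound, f0|].
    rewrite Rmult_comm; apply Rmult_le_compat_r; [apply Hb0|].
    apply (sum_le_point (fun k => Cmod (f k) * wt k)), Hb.
  - apply sum_le_scal; [|exact Hb].
    eapply Rle_trans; [apply (Hb0 0%Z)|apply (sum_le_point _ _ 0%Z Hb)].
  - rewrite (Xop_Xterm t s f j S f0 HS); exact HS.
Qed.

(* With k1 + k2 + k3 = 0 the summand is k3 times a symmetric function, so its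
   three cyclic permutations add up to zero. *)
Lemma pairing_Xop t s f : isL20 f ->
  has_csum (fun k => Cmult (f (- k)%Z) (Xop t s f f k)) (RtoC 0).
Proof.
  intros Hf; destruct (L20_facts f Hf) as (f0 & Hev & K & HK).
  assert (Hb := sum_le_Cmod_wt f K HK).
  assert (Hb0 : forall k, 0 <= Cmod (f k) * wt k)
    by (intros k; apply Rmult_le_pos; [apply Cmod_ge_0|left; apply wt_pos]).
  pose (P := fun x : Z * Z => Cmult (f (- fst x)%Z) (Xterm s t f (fst x) (snd x))).
  pose (b := fun k => Cmod (f k) * wt k).
  set (B := (K + 5) / 2) in *.
  assert (HB : 0 <= B) by (eapply Rle_trans; [apply (Hb0 0%Z)|apply (sum_le_point _ _ 0%Z Hb)]).
  assert (HK0 : 0 <= K) by (apply (HK nil); constructor).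
  (* The factor f(-j) is bounded only by its supremum. The change of variables (j, m) to (m, j-m)
     turns the rest into a product of two summable sequences. *)
  destruct (has_csum_ex P (fun x => (1 + K) * (b (snd x) * b (fst x - snd x)%Z))
     ((1 + K) * (B * B))) as [S HS].
  - intros [j m]; unfold P, b; simpl fst; simpl snd.
    rewrite Cmod_mult, Hev; apply Rmult_le_compat; try apply Cmod_ge_0.
    + assert (H := sum_le_point _ _ j HK); simpl in H.
      assert (H1 := pow2_ge_0 (Cmod (f j) - 1)); nra.
    + apply Xterm_bound, f0.
  - apply sum_le_scal; [lra|].
    apply (sum_le_inj (fun x : Z * Z => (snd x, (fst x - snd x)%Z)) (fun y => b (fst y) * b (snd y))).
    { intros [x1 x2] [y1 y2]; simpl; intros H; injection H; intros; f_equal; lia. }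
    apply (sum_le_prod _ (fun m => B * b m)).
    + intros [m n]; apply Rmult_le_pos; apply Hb0.
    + intros m; simpl; rewrite (Rmult_comm B); apply sum_le_scal; [apply Hb0|exact Hb].
    + apply sum_le_scal; [exact HB|exact Hb].
  (* On the zero-sum triple (-j, m, j-m), [e] is a cyclic shift and [e'] its inverse. *)
  - pose (e := fun x : Z * Z => ((- snd x)%Z, (fst x - snd x)%Z)).
    pose (e' := fun x : Z * Z => ((snd x - fst x)%Z, (- fst x)%Z)).
    assert (He : forall x, e (e' x) = x)
      by (intros [x y]; unfold e, e'; simpl; f_equal; lia).
    assert (He' : forall x, e' (e x) = x)
      by (intros [x y]; unfold e, e'; simpl; f_equal; lia).
    assert (H1 := has_csum_reindex e e' P S He He' HS).
    assert (H2 := has_csum_reindex e' e P S He' He HS).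
    assert (H := has_csum_plus _ _ _ _ HS (has_csum_plus _ _ _ _ H1 H2)).
    assert (H0 : has_csum (fun _ : Z * Z => RtoC 0) (RtoC 0)) by (split; apply has_sum_0).
    assert (ES : Cplus S (Cplus S S) = RtoC 0).
    { eapply has_csum_unique; [exact H|].
      eapply has_csum_ext; [|exact H0]; intros [j m].
      unfold P, e, e', Xterm; simpl fst; simpl snd.
      replace (- - m)%Z with m by lia.
      replace (- (m - j))%Z with (j - m)%Z by lia.
      replace (- m - (j - m))%Z with (- j)%Z by lia.
      replace (m - j - - j)%Z with m by lia.
      replace (3 * IZR (- m) * IZR (j - m) * IZR (- j)) with (3 * IZR j * IZR m * IZR (j - m))
        by (rewrite !opp_IZR; ring).
      replace (3 * IZR (m - j) * IZR (- j) * IZR m) with (3 * IZR j * IZR m * IZR (j - m))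
        by (rewrite !opp_IZR, !minus_IZR; ring).
      rewrite opp_IZR, (minus_IZR m j); unfold Rdiv, Rminus.
      rewrite !RtoC_mult, RtoC_plus, !RtoC_opp; ring. }
    assert (ES0 : S = RtoC 0).
    { destruct S as [x y]; injection ES; intros; apply C_ext; simpl; lra. }
    rewrite ES0 in HS.
    apply (has_csum_fubini P); [exact HS|].
    intros k; unfold P; simpl; apply has_csum_scal, Xop_has_csum, Hf.
Qed.

(** * The cubic term *)

(** The prefactor is 2 (ik/2)(i(k-q)/2). It vanishes at q = k. The other frequencies excluded in
    [X2op] drop out as soon as f vanishes at 0, so no restriction on the indices is kept. *)
Definition X2term (s t : R) (f : fourier) (k q m : Z) : C :=
  Cmult (Cmult (RtoC (- (IZR k * IZR (k - q) / 2)))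
    (Jint (3 * IZR k * IZR q * IZR (k - q)) (3 * IZR (k - q) * IZR m * IZR (k - q - m)) s t))
    (Cmult (f q) (Cmult (f m) (f (k - q - m)%Z))).

Lemma X2op_X2term (t s : R) (f : fourier) (k : Z) S : f 0%Z = RtoC 0 ->
  has_csum (fun x => X2term s t f k (fst x) (snd x)) S -> X2op t s f f f k = S.
Proof.
  intros f0 H; apply zsum2_has_csum; eapply has_csum_ext; [|exact H].
  intros [q m]; unfold X2term; simpl fst; simpl snd; cbv zeta.
  destruct (Z.eqb_spec q 0) as [->|Hq]; [rewrite f0; simpl orb; cbv iota; ring|].
  destruct (Z.eqb_spec q k) as [->|Hk].
  { simpl orb; cbv iota; rewrite Z.sub_diag.
    replace (- (IZR k * 0 / 2)) with 0 by field; ring. }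
  destruct (Z.eqb_spec m 0) as [->|Hm]; [rewrite f0; simpl orb; cbv iota; ring|].
  destruct (Z.eqb_spec m (k - q)) as [->|Hn].
  { simpl orb; cbv iota; rewrite Z.sub_diag, f0; ring. }
  simpl orb; cbv iota.
  set (J := Jint _ _ _ _); set (x := f q); set (y := f m); set (z := f (k - q - m)%Z).
  set (F := Cmult x (Cmult y z)); clearbody J F.
  apply C_ext; destruct J, F; simpl; field.
Qed.

(* The sum of the two phases is 3 (n+m)(q+m)(q+n); off the resonances q = -m, q = -n,
   writing the factor q+m+n as (q+m) + n leaves only summable weights. *)
Lemma X2_coeff_bound s t (q m n : Z) :
  q <> 0%Z -> m <> 0%Z -> n <> 0%Z -> (q + m + n)%Z <> 0%Z -> (n + m)%Z <> 0%Z ->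
  Rabs (IZR (q + m + n) * IZR (n + m) / 2) *
  Cmod (Jint (3 * IZR (q + m + n) * IZR q * IZR (n + m)) (3 * IZR (n + m) * IZR m * IZR n) s t)
  <= 2 * (wt m * wt n) + wt m * wt (n + m) * wt (q + m) +
     Rabs (t - s) * delta (q + m) + Rabs (t - s) * delta (q + n).
Proof.
  intros Hq Hm Hn Hk Hj.
  rewrite (wt_neq0 m Hm), (wt_neq0 n Hn), (wt_neq0 _ Hj).
  assert (Hq1 := IZR_abs_ge1 _ Hq); assert (Hm1 := IZR_abs_ge1 _ Hm).
  assert (Hn1 := IZR_abs_ge1 _ Hn); assert (Hk1 := IZR_abs_ge1 _ Hk).
  assert (Hj1 := IZR_abs_ge1 _ Hj).
  assert (HD := Rabs_pos (t - s)).
  assert (Hdm := delta_ge0 (q + m)); assert (Hdn := delta_ge0 (q + n)).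
  assert (Hwu := wt_pos (q + m)).
  assert (HJ := Jint_bound (3 * IZR (q + m + n) * IZR q * IZR (n + m))
    (3 * IZR (n + m) * IZR m * IZR n) s t
    ltac:(repeat apply Rmult_integral_contrapositive_currified; try lra; apply not_0_IZR; assumption)).
  assert (HE := Eint_bound (3 * IZR (q + m + n) * IZR q * IZR (n + m)) s t
    ltac:(repeat apply Rmult_integral_contrapositive_currified; try lra; apply not_0_IZR; assumption)).
  replace (3 * IZR (q + m + n) * IZR q * IZR (n + m) + 3 * IZR (n + m) * IZR m * IZR n)
    with (3 * IZR (n + m) * IZR (q + m) * IZR (q + n)) in HJ
    by (rewrite !plus_IZR; ring).
  set (e1 := Cmod (Eint (3 * IZR (q + m + n) * IZR q * IZR (n + m)) s t)) in *.
  set (e2 := Cmod (Eint (3 * IZR (n + m) * IZR (q + m) * IZR (q + n)) s t)) in *.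
  (* This is the share of [e2] after multiplying out. In the share of [e1] the outer frequency q+m+n
     cancels against the phase, but the phase of [e2] does not contain it, so it has to be absorbed
     here. *)
  assert (He2 : Rabs (IZR (q + m + n)) * e2 / (6 * Rabs (IZR m) * Rabs (IZR n)) <=
    / Rabs (IZR m) * / Rabs (IZR n) + / Rabs (IZR m) * / Rabs (IZR (n + m)) * wt (q + m) +
    Rabs (t - s) * delta (q + m) + Rabs (t - s) * delta (q + n)).
  { assert (Hmn : 0 < / Rabs (IZR m) * / Rabs (IZR n))
      by (apply Rmult_lt_0_compat; apply Rinv_0_lt_compat; lra).
    assert (Hmj : 0 < / Rabs (IZR m) * / Rabs (IZR (n + m)) * wt (q + m))
      by (repeat apply Rmult_lt_0_compat; try apply Rinv_0_lt_compat; lra).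
    assert (Hdm' : 0 <= Rabs (t - s) * delta (q + m)) by (apply Rmult_le_pos; lra).
    assert (Hdn' : 0 <= Rabs (t - s) * delta (q + n)) by (apply Rmult_le_pos; lra).
    assert (Hres : forall x, 1 <= x -> Rabs (t - s) / (6 * x) <= Rabs (t - s)).
    { intros x Hx; apply Rmult_le_reg_r with (6 * x); [lra|].
      replace (Rabs (t - s) / (6 * x) * (6 * x)) with (Rabs (t - s)) by (field; lra).
      nra. }
    destruct (Z.eq_dec (q + m) 0) as [Hu|Hu]; [|destruct (Z.eq_dec (q + n) 0) as [Hv|Hv]].
    (* On q = -m the outer frequency equals n and is absorbed by 1/|n|. The case q = -n is the same
       with m and n exchanged. *)
    - assert (e2 = Rabs (t - s)) as ->.
      { unfold e2; rewrite Hu; replace (3 * IZR (n + m) * 0 * IZR (q + n)) with 0 by ring.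
        rewrite Eint_0; apply Cmod_R. }
      assert (delta (q + m) = 1) as E1 by (unfold delta; destruct Z.eq_dec; [reflexivity|lia]).
      replace (q + m + n)%Z with n by lia.
      replace (Rabs (IZR n) * Rabs (t - s) / (6 * Rabs (IZR m) * Rabs (IZR n))) with
        (Rabs (t - s) / (6 * Rabs (IZR m))) by (field; lra).
      assert (H := Hres _ Hm1); rewrite E1 in *; lra.
    - assert (e2 = Rabs (t - s)) as ->.
      { unfold e2; rewrite Hv; rewrite Rmult_0_r, Eint_0; apply Cmod_R. }
      assert (delta (q + n) = 1) as E1 by (unfold delta; destruct Z.eq_dec; [reflexivity|lia]).
      replace (q + m + n)%Z with m by lia.
      replace (Rabs (IZR m) * Rabs (t - s) / (6 * Rabs (IZR m) * Rabs (IZR n))) with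
        (Rabs (t - s) / (6 * Rabs (IZR n))) by (field; lra).
      assert (H := Hres _ Hn1); rewrite E1 in *; lra.
    - assert (H2 : e2 <= 2 / (3 * Rabs (IZR (n + m)) * Rabs (IZR (q + m)) * Rabs (IZR (q + n)))).
      { unfold e2; eapply Rle_trans; [apply Eint_bound|].
        - repeat apply Rmult_integral_contrapositive_currified; try lra; apply not_0_IZR; assumption.
        - rewrite !Rabs_mult, (Rabs_pos_eq 3) by lra; lra. }
      rewrite (wt_neq0 _ Hu) in *.
      assert (Hu1 := IZR_abs_ge1 _ Hu); assert (Hv1 := IZR_abs_ge1 _ Hv).
      assert (Hsplit : Rabs (IZR (q + m + n)) <= Rabs (IZR (q + m)) + Rabs (IZR n))
        by (rewrite (plus_IZR (q + m) n); apply Rabs_triang).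
      set (M := Rabs (IZR m)) in *; set (N := Rabs (IZR n)) in *; set (J := Rabs (IZR (n + m))) in *.
      set (U := Rabs (IZR (q + m))) in *; set (V := Rabs (IZR (q + n))) in *.
      set (K := Rabs (IZR (q + m + n))) in *.
      apply Rle_trans with ((U + N) * (2 / (3 * J * U * V)) / (6 * M * N)).
      + apply Rmult_le_compat_r; [left; apply Rinv_0_lt_compat; nra|].
        apply Rmult_le_compat; try lra; apply Cmod_ge_0.
      + replace ((U + N) * (2 / (3 * J * U * V)) / (6 * M * N)) with
          (/ M * / N * (/ 9 * (/ J * / V)) + / M * / J * / U * (/ 9 * / V)) by (field; lra).
        assert (HiV : / V <= 1) by (rewrite <- Rinv_1; apply Rinv_le_contravar; lra).
        assert (HiJ : / J <= 1) by (rewrite <- Rinv_1; apply Rinv_le_contravar; lra).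
        assert (HiV0 : 0 < / V) by (apply Rinv_0_lt_compat; lra).
        assert (HiJ0 : 0 < / J) by (apply Rinv_0_lt_compat; lra).
        assert (/ J * / V <= 1) by nra.
        assert (/ M * / N * (/ 9 * (/ J * / V)) <= / M * / N) by nra.
        assert (/ M * / J * / U * (/ 9 * / V) <= / M * / J * / U) by nra.
        lra. }
  rewrite !Rabs_mult, (Rabs_pos_eq 3) in HJ by lra.
  rewrite !Rabs_mult, (Rabs_pos_eq 3) in HE by lra.
  unfold Rdiv at 1; rewrite !Rabs_mult, (Rabs_pos_eq (/ 2)) by lra.
  clearbody e1 e2.
  set (JJ := Cmod (Jint _ _ _ _)) in *; clearbody JJ.
  set (M := Rabs (IZR m)) in *; set (N := Rabs (IZR n)) in *; set (J := Rabs (IZR (n + m))) in *.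
  set (Q := Rabs (IZR q)) in *; set (K := Rabs (IZR (q + m + n))) in *.
  apply Rle_trans with (K * J * / 2 * ((2 / (3 * K * Q * J) + e2) / (3 * J * M * N))).
  - apply Rmult_le_compat_l; [nra|].
    eapply Rle_trans; [exact HJ|].
    apply Rmult_le_compat_r; [|lra].
    left; apply Rinv_0_lt_compat; repeat apply Rmult_lt_0_compat; lra.
  - replace (K * J * / 2 * ((2 / (3 * K * Q * J) + e2) / (3 * J * M * N))) with
      (/ M * / N * (/ 9 * (/ Q * / J)) + K * e2 / (6 * M * N)) by (field; lra).
    assert (HiQ : / Q <= 1) by (rewrite <- Rinv_1; apply Rinv_le_contravar; lra).
    assert (HiJ : / J <= 1) by (rewrite <- Rinv_1; apply Rinv_le_contravar; lra).
    assert (HiQ0 : 0 < / Q) by (apply Rinv_0_lt_compat; lra).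
    assert (HiJ0 : 0 < / J) by (apply Rinv_0_lt_compat; lra).
    assert (/ Q * / J <= 1) by nra.
    assert (0 < / M * / N) by (apply Rmult_lt_0_compat; apply Rinv_0_lt_compat; lra).
    assert (/ M * / N * (/ 9 * (/ Q * / J)) <= / M * / N) by nra.
    lra.
Qed.

Definition X2pair (s t : R) (f : fourier) (x : Z * (Z * Z)) : C :=
  Cmult (f (- fst x)%Z) (X2term s t f (fst x) (fst (snd x)) (snd (snd x))).

(** [X2_coeff_bound] asks for nonzero frequencies. When one vanishes the summand is zero, either
    because f vanishes at 0 or, for n + m = 0, through the inner derivative. *)
Lemma X2pair_bound s t f x : f 0%Z = RtoC 0 -> (forall k, Cmod (f (- k)%Z) = Cmod (f k)) ->
  Cmod (X2pair s t f x) <=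
  quartic_dom (Rabs (t - s)) (fun k => Cmod (f k))
    (snd (snd x)) (fst x - fst (snd x) - snd (snd x))%Z (fst (snd x)).
Proof.
  intros f0 Hev; destruct x as [k [q m]]; simpl fst; simpl snd.
  remember (k - q - m)%Z as n eqn:En.
  assert (Ek : k = (q + m + n)%Z) by lia; subst k; clear En.
  unfold X2pair, X2term, quartic_dom; simpl fst; simpl snd.
  replace (q + m + n - q)%Z with (n + m)%Z by lia.
  replace (n + m - m)%Z with n by lia.
  rewrite !Cmod_mult, Hev, Cmod_R.
  assert (Hrhs : 0 <= Cmod (f m) * Cmod (f n) * Cmod (f q) * Cmod (f (q + m + n)%Z) *
    (2 * (wt m * wt n) + wt m * wt (n + m) * wt (q + m) +
     Rabs (t - s) * delta (q + m) + Rabs (t - s) * delta (q + n))).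
  { assert (H1 := wt_pos m); assert (H2 := wt_pos n); assert (H3 := wt_pos (n + m)).
    assert (H4 := wt_pos (q + m)); assert (H5 := delta_ge0 (q + m)); assert (H6 := delta_ge0 (q + n)).
    assert (H7 := Rabs_pos (t - s)).
    apply Rmult_le_pos; [repeat apply Rmult_le_pos; apply Cmod_ge_0|].
    repeat apply Rplus_le_le_0_compat; repeat apply Rmult_le_pos; lra. }
  assert (Hz : forall k, k = 0%Z -> Cmod (f k) = 0) by (intros k ->; rewrite f0; apply Cmod_0).
  destruct (Z.eq_dec q 0) as [E|Hq].
  { eapply Rle_trans; [right|exact Hrhs]; rewrite (Hz q E); ring. }
  destruct (Z.eq_dec m 0) as [E|Hm].
  { eapply Rle_trans; [right|exact Hrhs]; rewrite (Hz m E); ring. }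
  destruct (Z.eq_dec n 0) as [E|Hn].
  { eapply Rle_trans; [right|exact Hrhs]; rewrite (Hz n E); ring. }
  destruct (Z.eq_dec (q + m + n) 0) as [E|Hk].
  { eapply Rle_trans; [right|exact Hrhs]; rewrite (Hz _ E); ring. }
  destruct (Z.eq_dec (n + m) 0) as [E|Hj].
  { eapply Rle_trans; [right|exact Hrhs]; rewrite E.
    replace (- (IZR (q + m + n) * 0 / 2)) with 0 by field; rewrite Rabs_R0; ring. }
  rewrite Rabs_Ropp.
  assert (H := X2_coeff_bound s t q m n Hq Hm Hn Hk Hj).
  set (c := Rabs (_ / 2)) in *; set (J := Cmod (Jint _ _ _ _)) in *.
  replace (Cmod (f (q + m + n)%Z) * (c * J * (Cmod (f q) * (Cmod (f m) * Cmod (f n))))) with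
    (Cmod (f m) * Cmod (f n) * Cmod (f q) * Cmod (f (q + m + n)%Z) * (c * J)) by ring.
  apply Rmult_le_compat_l; [repeat apply Rmult_le_pos; apply Cmod_ge_0|exact H].
Qed.

Lemma X2pair_has_csum_ex s t f : isL20 f -> exists S, has_csum (X2pair s t f) S.
Proof.
  intros Hf; destruct (L20_facts f Hf) as (f0 & Hev & K & HK).
  destruct (sum_le_quartic_dom (Rabs (t - s)) (fun k => Cmod (f k)) K) as [K' HK'];
    [apply Rabs_pos|intros; apply Cmod_ge_0|exact Hev|exact HK|].
  eapply has_csum_ex; [intros x; apply X2pair_bound; assumption|].
  apply (sum_le_inj (fun x : Z * (Z * Z) =>
    (snd (snd x), ((fst x - fst (snd x) - snd (snd x))%Z, fst (snd x))))
    (fun x : Z * (Z * Z) => quartic_dom (Rabs (t - s)) (fun k => Cmod (f k)) (fst x) (fst (snd x)) (snd (snd x))) K'); [|exact HK'].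
  intros [k [q m]] [k' [q' m']]; simpl; intros H; injection H; intros.
  repeat f_equal; lia.
Qed.

(** The majorant controls only the paired summand, so convergence of the double sum defining [X2op]
    at frequency k is recovered by dividing the slice of the triple sum by f(-k). *)
Lemma X2op_pairing_has_csum s t f S : isL20 f -> has_csum (X2pair s t f) S ->
  has_csum (fun k => Cmult (f (- k)%Z) (X2op t s f f f k)) S.
Proof.
  intros Hf HS; destruct (L20_facts f Hf) as (f0 & Hev & K & HK).
  apply (has_csum_fubini (X2pair s t f)); [exact HS|]; intros k.
  destruct (sum_le_quartic_dom (Rabs (t - s)) (fun k => Cmod (f k)) K) as [K' HK'];
    [apply Rabs_pos|intros; apply Cmod_ge_0|exact Hev|exact HK|].
  destruct (has_csum_ex (fun b => X2pair s t f (k, b))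
    (fun b => quartic_dom (Rabs (t - s)) (fun k => Cmod (f k))
       (snd b) (k - fst b - snd b)%Z (fst b)) K') as [Sk HSk].
  { intros b; apply (X2pair_bound s t f (k, b)); assumption. }
  { apply (sum_le_inj (fun b : Z * Z => (snd b, ((k - fst b - snd b)%Z, fst b)))
      (fun x : Z * (Z * Z) => quartic_dom (Rabs (t - s)) (fun k => Cmod (f k)) (fst x) (fst (snd x)) (snd (snd x))) K');
      [|exact HK'].
    intros [q m] [q' m']; simpl; intros H; injection H; intros; f_equal; lia. }
  (* If [f (-k) = 0] nothing is known about the inner sum, but it is multiplied by 0. *)
  destruct (Ceq_dec (f (- k)%Z) (RtoC 0)) as [E|E].
  - rewrite E; rewrite Cmult_0_l.
    apply (has_csum_ext (fun _ => RtoC 0)); [|split; apply has_sum_0].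
    intros b; unfold X2pair; simpl fst; rewrite E; ring.
  - rewrite (X2op_X2term t s f k (Cmult (Cinv (f (- k)%Z)) Sk) f0).
    + rewrite Cmult_assoc, Cinv_r, Cmult_1_l by exact E; exact HSk.
    + eapply has_csum_ext; [|apply has_csum_scal, HSk].
      intros b; unfold X2pair; simpl fst; simpl snd.
      rewrite Cmult_assoc, Cinv_l, Cmult_1_l by exact E; reflexivity.
Qed.

(** * Symmetrisation and the exact cubic cancellation *)

Lemma has_csum_mul {A B} (f : A -> C) (g : B -> C) (bf : A -> R) (bg : B -> R) K K' S S' :
  (forall x, Cmod (f x) <= bf x) -> (forall y, Cmod (g y) <= bg y) ->
  sum_le bf K -> sum_le bg K' -> has_csum f S -> has_csum g S' ->
  has_csum (fun x : A * B => Cmult (f (fst x)) (g (snd x))) (Cmult S S').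
Proof.
  intros Hf Hg Hbf Hbg HS HS'.
  assert (Hf0 : forall x, 0 <= bf x)
    by (intros x; eapply Rle_trans; [apply Cmod_ge_0|apply Hf]).
  assert (Hg0 : forall x, 0 <= bg x)
    by (intros x; eapply Rle_trans; [apply Cmod_ge_0|apply Hg]).
  assert (HK' : 0 <= K') by (apply (Hbg nil); constructor).
  destruct (has_csum_ex (fun x : A * B => Cmult (f (fst x)) (g (snd x)))
    (fun x => bf (fst x) * bg (snd x)) (K' * K)) as [P HP].
  - intros x; rewrite Cmod_mult; apply Rmult_le_compat; auto; apply Cmod_ge_0.
  - apply (sum_le_prod _ (fun x => K' * bf x)).
    + intros x; apply Rmult_le_pos; auto.
    + intros x; simpl; rewrite Rmult_comm; apply sum_le_scal; auto.
    + apply sum_le_scal; assumption.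
  (* Domination gives a joint sum [P] without its value. Fubini identifies it: summing out the
     second index leaves the family S' f(x), whose total is known. *)
  - replace (Cmult S S') with P; [exact HP|].
    apply (has_csum_unique (fun x => Cmult S' (f x))).
    + apply (has_csum_fubini _ _ _ HP); intros x; simpl.
      rewrite Cmult_comm; apply has_csum_scal, HS'.
    + rewrite Cmult_comm; apply has_csum_scal, HS.
Qed.

(** Up to the factor -1/2, this is the expansion of the sum over j of |X(j)|^2, where j = k - q. *)
Definition EEterm (s t : R) (f : fourier) (x : Z * (Z * Z)) : C :=
  let '(k, (q, m)) := x in
  Cmult (RtoC (- (IZR (k - q) * IZR (k - q) / 2)))
   (Cmult (Cmult (Eint (3 * IZR k * IZR q * IZR (k - q)) s t)
                 (Eint (3 * IZR (k - q) * IZR m * IZR (k - q - m)) s t))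
    (Cmult (Cmult (f (- k)%Z) (f q)) (Cmult (f m) (f (k - q - m)%Z)))).

(* With p = -k, j = k - q, n = j - m (so p + q + m + n = 0): exchanging p and q
   turns the factor k into -j/2; exchanging (p,q) and (m,n) then symmetrises the
   iterated integral into a product. *)
Lemma X2pair_symmetrised s t f S : f 0%Z = RtoC 0 ->
  has_csum (X2pair s t f) S -> has_csum (EEterm s t f) (Cmult (RtoC 4) S).
Proof.
  intros f0 HS.
  pose (e1 := fun x : Z * (Z * Z) => let '(k, (q, m)) := x in ((- q)%Z, ((- k)%Z, m))).
  pose (e2 := fun x : Z * (Z * Z) => let '(k, (q, m)) := x in ((- m)%Z, ((k - q - m)%Z, (- k)%Z))).
  assert (He1 : forall x, e1 (e1 x) = x)
    by (intros [k [q m]]; unfold e1; repeat f_equal; lia).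
  assert (He2 : forall x, e2 (e2 x) = x)
    by (intros [k [q m]]; unfold e2; repeat f_equal; lia).
  (* [e1] preserves j and both phases, so adding the two summands combines -kj/2 and qj/2 into
     -j^2/2. [e2] sends j to -j, which leaves j^2 unchanged, and exchanges the two phases. *)
  pose (H2 := fun x : Z * (Z * Z) => let '(k, (q, m)) := x in
    Cmult (RtoC (- (IZR (k - q) * IZR (k - q) / 2)))
    (Cmult (Jint (3 * IZR k * IZR q * IZR (k - q)) (3 * IZR (k - q) * IZR m * IZR (k - q - m)) s t)
     (Cmult (Cmult (f (- k)%Z) (f q)) (Cmult (f m) (f (k - q - m)%Z))))).
  assert (HS2 : has_csum H2 (Cplus S S)).
  { eapply has_csum_ext; [|exact (has_csum_plus _ _ _ _ HS (has_csum_reindex e1 e1 _ S He1 He1 HS))].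
    intros [k [q m]]; unfold X2pair, X2term, H2, e1; simpl fst; simpl snd.
    replace (- - q)%Z with q by lia; replace (- q - - k)%Z with (k - q)%Z by lia.
    replace (3 * IZR (- q) * IZR (- k) * IZR (k - q)) with (3 * IZR k * IZR q * IZR (k - q))
      by (rewrite !opp_IZR; ring).
    rewrite opp_IZR, minus_IZR.
    generalize (Jint (3 * IZR k * IZR q * (IZR k - IZR q))
      (3 * (IZR k - IZR q) * IZR m * IZR (k - q - m)) s t) (f (- k)%Z) (f q) (f m) (f (k - q - m)%Z).
    intros J a b c d; unfold Rdiv, Rminus.
    repeat (rewrite RtoC_opp || rewrite RtoC_mult || rewrite RtoC_plus).
    assert (H22 : Cmult (RtoC 2) (RtoC (/ 2)) = RtoC 1) by (rewrite <- RtoC_mult; f_equal; field).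
    ring. }
  replace (Cmult (RtoC 4) S) with (Cplus (Cplus S S) (Cplus S S))
    by (apply C_ext; destruct S; simpl; ring).
  eapply has_csum_ext; [|exact (has_csum_plus _ _ _ _ HS2 (has_csum_reindex e2 e2 _ _ He2 He2 HS2))].
  intros [k [q m]]; unfold H2, e2, EEterm.
  replace (- m - (k - q - m))%Z with (- (k - q))%Z by lia.
  replace (- - m)%Z with m by lia.
  replace (- (k - q) - - k)%Z with q by lia.
  replace (IZR (- (k - q)) * IZR (- (k - q))) with (IZR (k - q) * IZR (k - q))
    by (rewrite !opp_IZR; ring).
  replace (3 * IZR (- m) * IZR (k - q - m) * IZR (- (k - q))) with
    (3 * IZR (k - q) * IZR m * IZR (k - q - m)) by (rewrite !opp_IZR; ring).
  replace (3 * IZR (- (k - q)) * IZR (- k) * IZR q) with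
    (3 * IZR k * IZR q * IZR (k - q)) by (rewrite !opp_IZR; ring).
  set (al := 3 * IZR k * IZR q * IZR (k - q)).
  set (be := 3 * IZR (k - q) * IZR m * IZR (k - q - m)).
  (* [Jint_sym] needs both phases nonzero. Each way a phase can vanish also annihilates the
     coefficients of the summand. *)
  destruct (Z.eq_dec k 0) as [->|Hk]; [change (- 0)%Z with 0%Z; rewrite f0; ring|].
  destruct (Z.eq_dec q 0) as [->|Hq]; [rewrite f0; ring|].
  destruct (Z.eq_dec m 0) as [->|Hm]; [rewrite f0; ring|].
  destruct (Z.eq_dec (k - q - m) 0) as [E|Hn]; [rewrite E, f0; ring|].
  destruct (Z.eq_dec (k - q) 0) as [E|Hj].
  { rewrite E; replace (- (0 * 0 / 2)) with 0 by field; ring. }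
  rewrite <- (Jint_sym al be s t); [ring| |];
    unfold al, be; repeat apply Rmult_integral_contrapositive_currified; try lra;
    apply not_0_IZR; assumption.
Qed.

(** Write |X(j)|^2 as X(j) times its conjugate, the latter summed over -q. Conjugation reverses the
    phase, and reality of f turns the conjugated coefficients into f(q) and f(-(j+q)). With k = j +
    q this is -1/2 times [EEterm]. *)
Lemma Xop_norm2_has_csum s t f S : isL20 f -> has_csum (EEterm s t f) S ->
  has_csum (fun j => RtoC (Cmod (Xop t s f f j) ^ 2)) (Cmult (RtoC (- / 2)) S).
Proof.
  intros Hf HS; assert (Hc := proj1 (proj2 Hf)).
  pose (e := fun x : Z * (Z * Z) => let '(j, (m, q)) := x in ((j + q)%Z, (q, m))).
  pose (e' := fun x : Z * (Z * Z) => let '(k, (q, m)) := x in ((k - q)%Z, (m, q))).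
  assert (He : forall x, e (e' x) = x) by (intros [k [q m]]; unfold e, e'; repeat f_equal; lia).
  assert (He' : forall x, e' (e x) = x) by (intros [k [q m]]; unfold e, e'; repeat f_equal; lia).
  pose (Y := fun j q => Cconj (Xterm s t f j (- q))).
  assert (HY : forall j, has_csum (Y j) (Cconj (Xop t s f f j))).
  { intros j; unfold Y; apply (has_csum_conj (fun q => Xterm s t f j (- q))).
    apply (has_csum_reindex Z.opp Z.opp); try apply Z.opp_involutive.
    apply Xop_has_csum, Hf. }
  pose (F := fun x : Z * (Z * Z) => let '(j, (m, q)) := x in Cmult (Xterm s t f j m) (Y j q)).
  assert (HF : has_csum F (Cmult (RtoC (- / 2)) S)).
  { eapply has_csum_ext; [|exact (has_csum_scal (RtoC (- / 2)) _ _ (has_csum_reindex e e' _ S He He' HS))].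
    intros [j [m q]]; unfold e, F, Y, EEterm, Xterm.
    rewrite !Cmult_conj, Eint_conj, <- !Hc.
    replace (j + q - q)%Z with j by lia.
    replace (- - q)%Z with q by lia.
    replace (- (j - - q))%Z with (- (j + q))%Z by lia.
    replace (- (3 * IZR j * IZR (- q) * IZR (j - - q))) with (3 * IZR (j + q) * IZR q * IZR j)
      by (replace (j - - q)%Z with (j + q)%Z by lia; rewrite opp_IZR; ring).
    replace (Cconj Ci) with (Copp Ci) by (apply C_ext; simpl; ring).
    replace (Cconj (RtoC (IZR j / 2))) with (RtoC (IZR j / 2)) by (apply C_ext; simpl; ring).
    set (E1 := Eint _ _ _); set (E2 := Eint _ _ _).
    set (a := f (- (j + q))%Z); set (b := f q); set (c := f m); set (d := f (j - m)%Z).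
    transitivity (Cmult (Cmult (RtoC (- / 2)) (RtoC (- (IZR j * IZR j / 2))))
      (Cmult (Cmult E1 E2) (Cmult (Cmult a b) (Cmult c d)))); [ring|].
    transitivity (Cmult (Cmult (Cmult Ci (RtoC (IZR j / 2))) (Cmult (Copp Ci) (RtoC (IZR j / 2))))
      (Cmult (Cmult E1 E2) (Cmult (Cmult a b) (Cmult c d)))); [|ring].
    f_equal; apply C_ext; simpl; field. }
  apply (has_csum_fubini F); [exact HF|]; intros j.
  rewrite Cmod2_conj.
  destruct (L20_facts f Hf) as (f0 & Hev & K & HK).
  assert (Hb := sum_le_Cmod_wt f K HK).
  assert (Hb0 : forall k, 0 <= Cmod (f k) * wt k)
    by (intros k; apply Rmult_le_pos; [apply Cmod_ge_0|left; apply wt_pos]).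
  set (B := (K + 5) / 2) in *.
  assert (HB : 0 <= B) by (eapply Rle_trans; [apply (Hb0 0%Z)|apply (sum_le_point _ _ 0%Z Hb)]).
  pose (b := fun k => Cmod (f k) * wt k * B).
  assert (HbB : sum_le b (B * B)).
  { apply (sum_le_ext (fun k => B * (Cmod (f k) * wt k))); [intros; apply Rmult_comm|].
    apply sum_le_scal; assumption. }
  assert (HX : forall m, Cmod (Xterm s t f j m) <= b m).
  { intros m; eapply Rle_trans; [apply Xterm_bound, f0|].
    apply Rmult_le_compat_l; [apply Hb0|].
    apply (sum_le_point (fun k => Cmod (f k) * wt k)), Hb. }
  apply (has_csum_ext (fun x : Z * Z => Cmult (Xterm s t f j (fst x)) (Y j (snd x))));
    [intros [m q]; reflexivity|].
  apply (has_csum_mul _ _ b (fun q => b (- q)%Z) (B * B) (B * B)).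
  - exact HX.
  - intros q; unfold Y; rewrite Cmod_conj; apply HX.
  - exact HbB.
  - apply (sum_le_inj Z.opp b); [intros; lia|exact HbB].
  - apply Xop_has_csum, Hf.
  - apply HY.
Qed.

(** Symmetrisation multiplies the cubic pairing by 4 and identification with |X|^2 by -1/2, whence
    the -2. Since f(-k) is the conjugate of f(k), [Re S] is the real pairing of f with X2, up to the
    Parseval constant. *)
Lemma X2op_Xop_cancel s t f : isL20 f -> exists S,
  has_csum (fun k => Cmult (f (- k)%Z) (X2op t s f f f k)) S /\
  has_sum (fun k => Cmod (Xop t s f f k) ^ 2) (- 2 * Re S).
Proof.
  intros Hf; destruct (X2pair_has_csum_ex s t f Hf) as [S HS]; exists S; split.
  - apply X2op_pairing_has_csum; assumption.
  - destruct (Xop_norm2_has_csum s t f _ Hf (X2pair_symmetrised s t f S (proj1 Hf) HS)) as [H _].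
    replace (- 2 * Re S) with (Re (Cmult (RtoC (- / 2)) (Cmult (RtoC 4) S)));
      [exact H|destruct S; simpl; field].
Qed.

(** * Conservation *)

Lemma L2norm2_has_sum f : ex_series (sq_term f) ->
  has_sum (fun k => Cmod (f k) ^ 2) (L2norm2 f / (2 * PI)).
Proof.
  intros H; destruct (sq_summable_L2norm2 f H) as (S & HS & ->).
  assert (Hpi := PI_RGT_0).
  replace (2 * PI * S / (2 * PI)) with S by (field; lra); exact HS.
Qed.

Lemma has_sum_ge0 {A} (f : A -> R) S : (forall x, 0 <= f x) -> has_sum f S -> 0 <= S.
Proof. intros Hf H; exact (has_sum_le _ _ _ _ Hf has_sum_0 H). Qed.

(** The Parseval factor 2 pi exceeds 1 and is simply dropped. The bound [c] is nonnegative because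
    it dominates a norm, so it may be squared. *)
Lemma L2_le_has_sum g c : L2_le g c ->
  exists S, has_sum (fun k => Cmod (g k) ^ 2) S /\ S <= c ^ 2.
Proof.
  intros [Hex Hc]; destruct (sq_summable_L2norm2 g Hex) as (S & HS & E); exists S; split; [exact HS|].
  assert (HS0 := has_sum_ge0 _ _ (fun k => pow2_ge_0 (Cmod (g k))) HS).
  assert (Hpi := PI_RGT_0); assert (Hpi2 := PI2_1).
  assert (H0 := sqrt_pos (L2norm2 g)).
  assert (H1 : sqrt (L2norm2 g) ^ 2 = L2norm2 g) by (apply pow2_sqrt; rewrite E; nra).
  unfold L2norm in Hc.
  assert (L2norm2 g <= c ^ 2) by (rewrite <- H1; apply pow_incr; lra).
  nra.
Qed.

Lemma Cmod2_components z : Cmod z ^ 2 = Re z ^ 2 + Im z ^ 2.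
Proof.
  unfold Cmod; rewrite pow2_sqrt; [reflexivity|].
  apply Rplus_le_le_0_compat; apply pow2_ge_0.
Qed.

Lemma AM_GM_weighted l x y : 0 < l -> Rabs (2 * (x * y)) <= l * x ^ 2 + / l * y ^ 2.
Proof.
  intros Hl.
  assert (H1 : 0 <= / l * (l * x - y) ^ 2)
    by (apply Rmult_le_pos; [left; apply Rinv_0_lt_compat, Hl|apply pow2_ge_0]).
  assert (H2 : 0 <= / l * (l * x + y) ^ 2)
    by (apply Rmult_le_pos; [left; apply Rinv_0_lt_compat, Hl|apply pow2_ge_0]).
  replace (/ l * (l * x - y) ^ 2) with (l * x ^ 2 + / l * y ^ 2 - 2 * (x * y)) in H1 by (field; lra).
  replace (/ l * (l * x + y) ^ 2) with (l * x ^ 2 + / l * y ^ 2 + 2 * (x * y)) in H2 by (field; lra).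
  apply Rabs_le; lra.
Qed.

Lemma energy_expansion (f g x z : C) :
  Cmod g ^ 2 - Cmod f ^ 2 =
  2 * Re (Cmult (Cconj f) x) + 2 * Re (Cmult (Cconj f) z) + Cmod x ^ 2 +
  2 * Re (Cmult (Cconj f) (Cminus (Cminus (Cminus g f) x) z)) +
  2 * Re (Cmult (Cconj x) (Cminus (Cminus g f) x)) + Cmod (Cminus (Cminus g f) x) ^ 2.
Proof. rewrite !Cmod2_components; destruct f, g, x, z; simpl; ring. Qed.

(** The weights [l] and [mu] are left free, to be balanced against the sizes of r and w. With X = d
    - w, the coefficient of |w|^2 collects 2 mu from |d - w|^2 <= 2|d|^2 + 2|w|^2, 1/mu from AM-GM,
    and 1 from |w|^2 itself. *)
Lemma energy_increment s t f g l mu Hf Hg Sd Sw Sr :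
  isL20 f -> 0 < l -> 0 < mu ->
  let d := fsub g f in
  let w := fsub d (Xop t s f f) in
  let r := fsub w (X2op t s f f f) in
  has_sum (fun k => Cmod (f k) ^ 2) Hf -> has_sum (fun k => Cmod (g k) ^ 2) Hg ->
  has_sum (fun k => Cmod (d k) ^ 2) Sd -> has_sum (fun k => Cmod (w k) ^ 2) Sw ->
  has_sum (fun k => Cmod (r k) ^ 2) Sr ->
  Rabs (Hg - Hf) <= l * Hf + / l * Sr + (2 * mu * Sd + (2 * mu + / mu + 1) * Sw).
Proof.
  intros HL Hl Hmu d w r HHf HHg HSd HSw HSr.
  assert (Hc := proj1 (proj2 HL)).
  destruct (X2op_Xop_cancel s t f HL) as (S & [HS _] & HN).
  destruct (pairing_Xop t s f HL) as [HA _].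
  set (X := Xop t s f f) in *; set (X2 := X2op t s f f f) in *.
  assert (Hrem : has_sum (fun k => 2 * Re (Cmult (f (- k)%Z) (r k)) +
      (2 * Re (Cmult (Cconj (X k)) (w k)) + Cmod (w k) ^ 2)) (Hg - Hf)).
  (* The subtracted families have total zero by the two cancellations: the sum is unchanged while
     the summand shrinks to the remainder. *)
  { replace (Hg - Hf) with ((Hg - Hf) - (2 * Re (RtoC 0) + (2 * Re S + - 2 * Re S)))
      by (simpl; ring).
    eapply has_sum_ext; [|exact (has_sum_minus _ _ _ _ (has_sum_minus _ _ _ _ HHg HHf)
      (has_sum_plus _ _ _ _ (has_sum_scal 2 _ _ HA)
        (has_sum_plus _ _ _ _ (has_sum_scal 2 _ _ HS) HN)))].
    intros k.
    assert (E := energy_expansion (f k) (g k) (X k) (X2 k)).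
    unfold r, w, d, fsub; rewrite !Hc; lra. }
  assert (Hdom := has_sum_plus _ _ _ _
    (has_sum_plus _ _ _ _ (has_sum_scal l _ _ HHf) (has_sum_scal (/ l) _ _ HSr))
    (has_sum_plus _ _ _ _ (has_sum_scal (2 * mu) _ _ HSd)
       (has_sum_scal (2 * mu + / mu + 1) _ _ HSw))).
  assert (Hpt : forall k, Rabs (2 * Re (Cmult (f (- k)%Z) (r k)) +
      (2 * Re (Cmult (Cconj (X k)) (w k)) + Cmod (w k) ^ 2)) <=
      l * Cmod (f k) ^ 2 + / l * Cmod (r k) ^ 2 +
      (2 * mu * Cmod (d k) ^ 2 + (2 * mu + / mu + 1) * Cmod (w k) ^ 2)).
  { intros k; rewrite Hc.
    assert (HX : X k = Cminus (d k) (w k)) by (unfold w, fsub; ring).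
    rewrite HX, !Cmod2_components.
    destruct (f k) as [f1 f2], (r k) as [r1 r2], (d k) as [d1 d2], (w k) as [w1 w2].
    unfold Cconj, Cmult, Cminus, Cplus, Copp, Re, Im, fst, snd.
    assert (A1 := AM_GM_weighted l f1 r1 Hl); assert (A2 := AM_GM_weighted l f2 r2 Hl).
    assert (A3 := AM_GM_weighted mu (d1 + - w1) w1 Hmu).
    assert (A4 := AM_GM_weighted mu (d2 + - w2) w2 Hmu).
    assert (B1 : mu * (d1 + - w1) ^ 2 <= 2 * mu * d1 ^ 2 + 2 * mu * w1 ^ 2)
      by (assert (H := pow2_ge_0 (d1 + w1)); nra).
    assert (B2 : mu * (d2 + - w2) ^ 2 <= 2 * mu * d2 ^ 2 + 2 * mu * w2 ^ 2)
      by (assert (H := pow2_ge_0 (d2 + w2)); nra).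
    apply Rabs_le_between in A1; apply Rabs_le_between in A2.
    apply Rabs_le_between in A3; apply Rabs_le_between in A4.
    apply Rabs_le_between; rewrite !Rmult_plus_distr_r, !Rmult_plus_distr_l in *.
    assert (P1 := pow2_ge_0 w1); assert (P2 := pow2_ge_0 w2).
    lra. }
  apply Rabs_le; split.
  - apply Ropp_le_cancel; rewrite Ropp_involutive.
    replace (- (Hg - Hf)) with ((-1) * (Hg - Hf)) by ring.
    eapply has_sum_le; [|exact (has_sum_scal (-1) _ _ Hrem)|exact Hdom].
    intros k; assert (H := Hpt k); apply Rabs_le_between in H; simpl in *; lra.
  - eapply has_sum_le; [|exact Hrem|exact Hdom].
    intros k; eapply Rle_trans; [apply Rle_abs|apply Hpt].
Qed.

(** * Hölder exponent above one and conclusion *)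

Lemma Rpower_pos x y : 0 < Rpower x y.
Proof. apply exp_pos. Qed.

(** Over N equal steps the increments add up to at most K t (t/N)^(g-1), which tends to 0. *)
Lemma holder_gt1_const (h : R -> R) (T K g : R) :
  1 < g ->
  (forall s t, 0 <= s < t -> t <= T -> Rabs (h t - h s) <= K * Rpower (t - s) g) ->
  forall t, 0 <= t <= T -> h t = h 0.
Proof.
  intros Hg Hh t [Ht0 HtT].
  destruct (Req_dec t 0) as [->|Hne]; [reflexivity|].
  assert (Ht : 0 < t) by lra.
  assert (HK : 0 <= K).
  { specialize (Hh 0 t ltac:(lra) HtT).
    assert (H := Rabs_pos (h t - h 0)); assert (H1 := Rpower_pos (t - 0) g).
    apply Rnot_lt_le; intros HK; nra. }
  assert (Hz : Rabs (h t - h 0) <= 0).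
  { apply le_epsilon; intros eps He; rewrite Rplus_0_l.
    assert (Hp : 0 < eps / (K * t + 1)) by (apply Rdiv_lt_0_compat; nra).
    set (ep := eps / (K * t + 1)) in *.
    (* Chosen so that de^(g-1) = [ep]. The +1 in [ep] covers K = 0, and the +1 in [N] makes the step
       t/N at most [de]. *)
    set (de := Rpower ep (/ (g - 1))).
    assert (Hde : 0 < de) by apply Rpower_pos.
    destruct (nfloor_ex (t / de)) as [n [_ Hn]]; [apply Rlt_le, Rdiv_lt_0_compat; assumption|].
    set (N := INR n + 1) in *.
    assert (HN : 1 <= N) by (unfold N; assert (H := pos_INR n); lra).
    assert (Hstep : 0 < t / N) by (apply Rdiv_lt_0_compat; lra).
    assert (Hsmall : t / N <= de).
    { apply Rmult_le_reg_r with N; [lra|].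
      replace (t / N * N) with t by (field; lra).
      replace t with (t / de * de) by (field; lra).
      rewrite Rmult_comm; apply Rmult_le_compat_l; lra. }
    assert (Hpow : Rpower (t / N) g <= t / N * ep).
    { replace g with (1 + (g - 1)) at 1 by ring.
      rewrite Rpower_plus, Rpower_1 by exact Hstep.
      apply Rmult_le_compat_l; [lra|].
      apply Rle_trans with (Rpower de (g - 1)).
      - apply Rle_Rpower_l; lra.
      - unfold de; rewrite Rpower_mult, Rinv_l by lra; rewrite Rpower_1 by exact Hp; lra. }
    assert (Hind : forall k, (k <= S n)%nat ->
      Rabs (h (INR k * (t / N)) - h 0) <= INR k * (K * (t / N * ep))).
    { induction k as [|k IH]; intros Hk.
      - simpl; rewrite !Rmult_0_l, Rminus_diag, Rabs_R0; lra.
      - assert (Hk0 := pos_INR k).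
        assert (HkN : INR (S k) <= N) by (unfold N; rewrite <- S_INR; apply le_INR, Hk).
        assert (Hle : INR (S k) * (t / N) <= t).
        { replace t with (N * (t / N)) at 2 by (field; lra).
          apply Rmult_le_compat_r; lra. }
        assert (H1 : Rabs (h (INR (S k) * (t / N)) - h (INR k * (t / N))) <= K * (t / N * ep)).
        { eapply Rle_trans.
          - apply Hh; [rewrite S_INR; nra|lra].
          - replace (INR (S k) * (t / N) - INR k * (t / N)) with (t / N)
              by (rewrite S_INR; ring).
            apply Rmult_le_compat_l; assumption. }
        specialize (IH ltac:(lia)).
        replace (h (INR (S k) * (t / N)) - h 0) with
          ((h (INR (S k) * (t / N)) - h (INR k * (t / N))) + (h (INR k * (t / N)) - h 0)) by ring.
        eapply Rle_trans; [apply Rabs_triang|].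
        rewrite S_INR in *; lra. }
    specialize (Hind (S n) (le_n _)); rewrite S_INR in Hind; fold N in Hind.
    replace (N * (t / N)) with t in Hind by (field; lra).
    replace (N * (K * (t / N * ep))) with (K * t * ep) in Hind by (field; lra).
    eapply Rle_trans; [exact Hind|].
    replace eps with ((K * t + 1) * ep) by (unfold ep; field; nra).
    nra. }
  assert (H := Rabs_pos (h t - h 0)).
  assert (Hz' : Rabs (h t - h 0) = 0) by lra.
  apply Rabs_eq_0 in Hz'; lra.
Qed.

Lemma Rpower_nat_mult x y n : Rpower x (INR n * y) = Rpower x y ^ n.
Proof.
  rewrite Rmult_comm, <- Rpower_mult; apply Rpower_pow, Rpower_pos.
Qed.

Theorem theorem3 (eta T : R) (v : R -> fourier) :
  1 / 3 < eta ->
  KdV_Lambda_solution eta T v ->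
  forall t : R, 0 <= t <= T -> L2norm2 (v t) = L2norm2 (v 0).
Proof.
  intros Heta (HL & (C1 & H1) & (C2 & H2) & (C3 & H3)).
  assert (Hpi := PI_RGT_0).
  set (h := fun t => L2norm2 (v t) / (2 * PI)).
  assert (Hh : forall t, 0 <= t <= T -> has_sum (fun k => Cmod (v t k) ^ 2) (h t))
    by (intros t Ht; apply L2norm2_has_sum, (HL t Ht)).
  assert (Hh0 : forall t, 0 <= t <= T -> 0 <= h t)
    by (intros t Ht; eapply has_sum_ge0; [|apply Hh, Ht]; intros; apply pow2_ge_0).
  (* Bounds all powers of time increments. The strict s < t matters: [Rpower 0 eta] is 1, so
     increments of length zero are kept out of every estimate. *)
  set (Y := Rpower T eta).
  assert (HY : forall s t, 0 <= s < t -> t <= T -> Rpower (t - s) eta <= Y)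
    by (intros s t Hs Ht; apply Rle_Rpower_l; lra).
  assert (HY0 : 0 < Y) by apply Rpower_pos.
  (* [energy_increment] leaves a multiple of |v_s|^2 on the right, so a bound uniform in s is
     needed. It comes from |v_s|^2 <= 2|v_0|^2 + 2|v_s - v_0|^2. *)
  set (M := 2 * h 0 + 2 * (C1 * Y) ^ 2).
  assert (HM : forall s, 0 <= s <= T -> h s <= M).
  { intros s Hs.
    assert (H00 := Hh0 0 ltac:(lra)); assert (Hsq := pow2_ge_0 (C1 * Y)).
    destruct (Req_dec s 0) as [->|Hs0]; [unfold M; lra|].
    destruct (L2_le_has_sum _ _ (H1 0 s ltac:(lra) ltac:(lra))) as (Sd & HSd & HSd').
    assert (Sd <= (C1 * Y) ^ 2).
    { eapply Rle_trans; [exact HSd'|]; rewrite !Rpow_mult_distr.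
      apply Rmult_le_compat_l; [apply pow2_ge_0|].
      apply pow_incr; split; [left; apply Rpower_pos|apply HY; lra]. }
    assert (h s <= 2 * h 0 + 2 * Sd); [|unfold M; lra].
    eapply has_sum_le; [|apply Hh, Hs|exact (has_sum_plus _ _ _ _
      (has_sum_scal 2 _ _ (Hh 0 ltac:(lra))) (has_sum_scal 2 _ _ HSd))].
    intros k; cbv beta; unfold fsub; rewrite !Cmod2_components.
    destruct (v s k) as [a b], (v 0 k) as [c d]; simpl.
    assert (P1 := pow2_ge_0 (a - 2 * c)); assert (P2 := pow2_ge_0 (b - 2 * d)); nra. }
  intros t Ht.
  assert (Hconst : h t = h 0).
  (* The constant is the sum of those in [T1] to [T4]. Writing the exponent with [INR] lets
     [Rpower_nat_mult] turn real powers into natural powers of a single y. *)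
  { apply (holder_gt1_const h T (M + C3 ^ 2 + 2 * C1 ^ 2 + C2 ^ 2 * (2 * Y ^ 2 + 1 + Y)) (INR 3 * eta));
      [simpl; lra| |exact Ht].
    clear t Ht; intros s t Hs Ht.
    destruct (L2_le_has_sum _ _ (H1 s t ltac:(lra) Ht)) as (Sd & HSd & HSd').
    destruct (L2_le_has_sum _ _ (H2 s t ltac:(lra) Ht)) as (Sw & HSw & HSw').
    destruct (L2_le_has_sum _ _ (H3 s t ltac:(lra) Ht)) as (Sr & HSr & HSr').
    assert (Hy := Rpower_pos (t - s) eta); assert (HyY := HY s t Hs Ht).
    replace (2 * eta) with (INR 2 * eta) in HSw' by (simpl; ring).
    replace (3 * eta) with (INR 3 * eta) in HSr' by (simpl; ring).
    rewrite Rpower_nat_mult in *; set (y := Rpower (t - s) eta) in *; clearbody y.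
    assert (Hy3 : 0 < y ^ 3) by (apply pow_lt, Hy).
    (* Since |r|^2, |d|^2 and |w|^2 are of order y^6, y^2 and y^4, the choice l = y^3, mu = y makes
       every term of order y^3 or smaller. The extra powers of y are absorbed by [Y]. *)
    assert (Hinc := energy_increment s t (v s) (v t) (y ^ 3) y (h s) (h t) Sd Sw Sr
      (HL s ltac:(lra)) Hy3 Hy (Hh s ltac:(lra)) (Hh t ltac:(lra)) HSd HSw HSr).
    eapply Rle_trans; [exact Hinc|].
    assert (Hi : 0 < / y) by (apply Rinv_0_lt_compat, Hy).
    assert (T1 : y ^ 3 * h s <= M * y ^ 3)
      by (rewrite Rmult_comm; apply Rmult_le_compat_r; [lra|apply HM; lra]).
    assert (T2 : / y ^ 3 * Sr <= C3 ^ 2 * y ^ 3).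
    { replace (C3 ^ 2 * y ^ 3) with (/ y ^ 3 * (C3 * y ^ 3) ^ 2) by (field; lra).
      apply Rmult_le_compat_l; [left; apply Rinv_0_lt_compat, Hy3|exact HSr']. }
    assert (T3 : 2 * y * Sd <= 2 * C1 ^ 2 * y ^ 3).
    { replace (2 * C1 ^ 2 * y ^ 3) with (2 * y * (C1 * y) ^ 2) by ring.
      apply Rmult_le_compat_l; [lra|exact HSd']. }
    assert (T4 : (2 * y + / y + 1) * Sw <= C2 ^ 2 * (2 * Y ^ 2 + 1 + Y) * y ^ 3).
    { apply Rle_trans with ((2 * y + / y + 1) * (C2 * y ^ 2) ^ 2).
      - apply Rmult_le_compat_l; [lra|exact HSw'].
      - replace ((2 * y + / y + 1) * (C2 * y ^ 2) ^ 2) with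
          (C2 ^ 2 * (2 * y ^ 2 + 1 + y) * y ^ 3) by (field; lra).
        apply Rmult_le_compat_r; [lra|].
        apply Rmult_le_compat_l; [apply pow2_ge_0|nra]. }
    lra. }
  unfold h in Hconst.
  replace (L2norm2 (v t)) with (L2norm2 (v t) / (2 * PI) * (2 * PI)) by (field; lra).
  rewrite Hconst; field; lra.
Qed.
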